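(* Let $c>0$ and $c'\in\mathbb{R}$, and let $M=M_N$ be a sequence of positive integers with $\lim_{N\to\infty} M/N=c$ and $\lim_{N\to\infty}(M-cN)=c'$. Let $X_N$ be the $N\times N$ real Wishart matrix $X_N=\frac1N GG^t$, with $G$ an $N\times M$ matrix of i.i.d. real $\mathcal{N}(0,1)$ entries. Then for every $n\ge 1$ the limit $$m_n'=\lim_{N\to\infty}N\Big(\mathrm{E}(\mathrm{tr}(X_N^n))-\sum_{\pi\in NC(n)}c^{\#(\pi)}\Big)$$ exists and $$m_n'=\sum_{\pi\in NC(n)}c'\,\#(\pi)\,c^{\#(\pi)-1}+\sum_{\sigma\in S_{NC}^\delta(n,-n)}c^{\#(\sigma)/2}.$$
   Context: $\mathrm{tr}=N^{-1}\mathrm{Tr}$ is the normalized trace and $G^t$ is the transpose. $NC(n)$ is the set of non-crossing partitions of $[n]=\{1,\dots,n\}$; for a partition $\#(\pi)$ is the number of blocks; for a permutation $\#(\pi)$ is the number of cycles (fixed points included). Let $[\pm n]=\{\pm1,\dots,\pm n\}$ and let $S_{\pm n}$ be its symmetric group (products composed right to left). Let $\delta\in S_{\pm n}$, $\delta(k)=-k$; let $\gamma\in S_{\pm n}$ be the cycle $(1,2,\dots,n)$, acting trivially on negative numbers; put $\tilde\gamma=\gamma\delta\gamma^{-1}\delta=(1,2,\dots,n)(-n,\dots,-2,-1)$. A pairing is a permutation all of whose cycles have length 2. $S_{NC}^\delta(n,-n)$ is the set of $\sigma\in S_{\pm n}$ such that (1) the subgroup $\langle\sigma,\tilde\gamma\rangle$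 acts transitively on $[\pm n]$; (2) $\#(\sigma)+\#(\sigma^{-1}\tilde\gamma)=2n$; (3) $\sigma\delta$ is a pairing. *)

(* Defs.v *)
(* Written over the MathComp and MathComp-Analysis libraries. *)
From HB Require Import structures.
From mathcomp Require Import all_boot all_order all_algebra all_fingroup.

Set Implicit Arguments.
Unset Strict Implicit.
Unset Printing Implicit Defensive.

Import Order.TTheory GRing.Theory Num.Theory.

(* The set {1, ..., n} is represented by 'I_n; the shift by one preserves the
   linear and the cyclic order. *)
Definition noncrossing (n : nat) (p : {set {set 'I_n}}) : bool :=
  [forall B in p, forall C in p,
    forall i in B, forall j in C, forall k in B, forall l in C,
      [&& i < j, j < k & k < l] ==> (B == C)].

Definition NC (n : nat) : {set {set {set 'I_n}}} :=
  [set p : {set {set 'I_n}} | partition p [set: 'I_n] & noncrossing p].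

(* (true, k) stands for k and (false, k) for -k. *)
Definition pm (n : nat) : finType := (bool * 'I_n)%type.

Definition delta_fun (n : nat) (x : pm n) : pm n := (~~ x.1, x.2).

Lemma delta_fun_inj (n : nat) : injective (@delta_fun n).
Proof. by move=> [a i] [b j] [/negb_inj -> ->]. Qed.

Definition gamma_fun (n : nat) (x : pm n) : pm n :=
  if x.1 then (true, ordS x.2) else x.

Lemma gamma_fun_inj (n : nat) : injective (@gamma_fun n).
Proof. by move=> [[] i] [[] j] //= /(congr1 snd)/= /ordS_inj ->. Qed.

Definition delta (n : nat) : {perm pm n} := perm (@delta_fun_inj n).
Definition gamma (n : nat) : {perm pm n} := perm (@gamma_fun_inj n).

(* In {perm T} the product composes from left to right, (s * t) x = t (s x), so
   every product below lists its factors in the reverse of the right-to-left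
   order: this is gamma delta gamma^-1 delta. *)
Definition gammat (n : nat) : {perm pm n} :=
  (delta n * (gamma n)^-1 * delta n * gamma n)%g.

Definition ncycles (T : finType) (s : {perm T}) : nat := #|porbits s|.

Definition is_pairing (T : finType) (s : {perm T}) : bool :=
  [forall B in porbits s, #|B| == 2].

Definition SNCdelta (n : nat) : {set {perm pm n}} :=
  [set s : {perm pm n} |
    [&& [transitive <<[set s; gammat n]>>%g, on [set: pm n] | 'P],
        ncycles s + ncycles (gammat n * s^-1)%g == 2 * n
      & is_pairing (delta n * s)%g]].

(* Imported only here because classical_sets shadows partition and several
   notations for finite sets. *)
From mathcomp Require Import all_classical all_reals all_analysis.
Import numFieldNormedType.Exports.

Local Open Scope ring_scope.

Definition ntr (R : realType) (N : nat) (A : 'M[R]_N) : R := N%:R^-1 * \tr A.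

Definition mutually_independent (R : realType) (d : measure_display)
    (T : measurableType d) (P : probability T R) (I : finType)
    (X : I -> {RV P >-> R}) : Prop :=
  forall (J : {set I}) (B : I -> set R), (forall i, measurable (B i)) ->
    P (\bigcap_(i in [set` J]) (X i @^-1` B i))%classic =
    (\prod_(i in J) P (X i @^-1` B i)%classic)%E.

Definition iid_std_normal (R : realType) (d : measure_display)
    (T : measurableType d) (P : probability T R) (N M : nat)
    (G : 'I_N -> 'I_M -> {RV P >-> R}) : Prop :=
  mutually_independent (fun ij : 'I_N * 'I_M => G ij.1 ij.2) /\
  forall (i : 'I_N) (j : 'I_M) (A : set R), measurable A ->
    distribution P (G i j) A = normal_prob 0 1 A.

Definition wishart (R : realType) (d : measure_display)
    (T : measurableType d) (P : probability T R) (N M : nat)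
    (G : 'I_N -> 'I_M -> {RV P >-> R}) (w : T) : 'M[R]_N :=
  let g := \matrix_(i < N, j < M) G i j w in
  N%:R^-1 *: (g *m g^T).

(* Main.v *)
Require Import Defs.
From HB Require Import structures.
From mathcomp Require Import all_boot all_fingroup zify.

Set Implicit Arguments.
Unset Strict Implicit.
Unset Printing Implicit Defensive.

(** Expanding the trace and the matrix product, E(tr X^n) is N^-(n+1) times the
    sum over pairs of index functions f : [n] -> [N], h : [n] -> [M] of the
    expectation of a product of 2n Gaussian entries, one for each element of
    [pm n].  Wick's formula ([wick]) turns each expectation into the number of
    pairings p of [pm n] under which the entry labels are invariant.  Summing
    over f and h first, a pairing contributes a power of N and a power of M whose
    exponents count the common orbits of p with two fixed pairings, and for two
    pairings this is half the number of cycles of their product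
    ([card_pairings_invariant]).  With s = p delta this gives the genus expansion

      E(tr X^n) = N^-(n+1) sum_s M^(#(s)/2) N^(#(s^-1 gammat)/2),

    the sum being over all s such that s delta is a pairing
    ([expectation_ntr_wishart]).

    The powers of N are controlled by Euler's inequality ([euler_labelling]).
    If s and gammat generate a transitive group, the term has order at most 1/N,
    and exactly that order when s lies in [SNCdelta n].  Otherwise s preserves
    signs and is determined by a permutation a of [n] ([not_transitive_signed]).
    Then the exponents are #(a) and #(a^-1 cyc), where cyc is the long cycle of
    [n]: the term has order 1 when a has genus zero, and order at most 1/N^2 when it
    does not, because #(a) + #(a^-1 cyc) has the parity of n+1 ([genus_gap]).
    Mapping a to its set of cycles identifies the permutations of genus zero with
    the non-crossing partitions ([NC_genus0]).  Hence

      E(tr X^n) = sum_(pi in NC(n)) (M/N)^#(pi)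
                  + 1/N sum_(s in SNCdelta) (M/N)^(#(s)/2) + O(1/N^2),

    and N ((M/N)^k - c^k) tends to c' k c^(k-1) because N (M/N - c) tends
    to c' ([cvg_term_top]). *)

(** * Cycles of permutations and Euler's inequality *)

Section Cycles.
Variable T : finType.
Implicit Types (s t g : {perm T}) (x y a b : T).

Lemma porbit_invariant (U : Type) (L : T -> U) s x y :
  (forall z, L (s z) = L z) -> y \in porbit s x -> L y = L x.
Proof.
move=> Ls /porbitP[k ->]; elim: k => [|k IH]; first by rewrite expg0 perm1.
by rewrite expgSr permM Ls.
Qed.

Lemma porbit_trans s x y z : y \in porbit s x -> z \in porbit s y -> z \in porbit s x.
Proof. by rewrite -!eq_porbit_mem => /eqP -> . Qed.

Lemma perm_porbit s x : s x \in porbit s x.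
Proof. exact: (mem_porbit s 1 x). Qed.

Lemma card_porbits_cut s x y : x != y -> y \in porbit s x ->
  #|porbits (tperm x y * s)%g| = #|porbits s|.+1.
Proof.
move=> xy sxy; have := porbits_mul_tperm s x y.
by rewrite porbit_sym sxy xy /= addn0 addn1.
Qed.

Lemma card_porbits_join s x y : y \notin porbit s x ->
  #|porbits s| = #|porbits (tperm x y * s)%g|.+1.
Proof.
move=> sxy; have := porbits_mul_tperm s x y.
have -> : x != y by apply: contraNneq sxy => ->; exact: porbit_id.
by rewrite porbit_sym sxy /= addn1 addn2 => -[].
Qed.

Lemma card_porbits_conj s t : #|porbits (s ^ t)%g| = #|porbits s|.
Proof.
have orbE x : porbit (s ^ t)%g (t x) = t @: porbit s x.
  apply/setP => y; apply/porbitP/imsetP.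
    move=> [k ->]; exists ((s ^+ k)%g x); first exact: mem_porbit.
    by rewrite -conjXg permJ.
  by move=> [_ /porbitP[k ->] ->]; exists k; rewrite -conjXg permJ.
rewrite -(card_imset (mem (porbits s)) (imset_inj (@perm_inj _ t))).
congr #|pred_of_set _|; apply/setP => B; apply/imsetP/imsetP.
  move=> [x _ ->]; exists (porbit s (t^-1 x)%g); first exact: imset_f.
  by rewrite -orbE permKV.
by move=> [_ /imsetP[x _ ->] ->]; exists (t x); rewrite ?orbE.
Qed.

Lemma card_porbits_mulC s t : #|porbits (s * t)%g| = #|porbits (t * s)%g|.
Proof. by rewrite -(card_porbits_conj (t * s)%g t) conjgE !mulgA mulVg mul1g. Qed.

Lemma card_porbits1 : #|porbits (1 : {perm T})| = #|T|.
Proof.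
rewrite /porbits card_imset // => x y /eqP; rewrite eq_porbit_mem.
by case/porbitP => k ->; rewrite expg1n perm1.
Qed.

(** Euler's inequality for permutations that need not generate a transitive
    group.  The number of joint orbits appears as the number of values of an
    invariant labelling, which is easier to update than the orbits themselves:
    the induction cuts a cycle of [s] by a transposition, and when the two halves
    receive different labels these labels are merged. *)
Lemma euler_labelling s t : exists L : T -> T,
  [/\ forall x, L (s x) = L x, forall x, L (t x) = L x &
      #|porbits s| + #|porbits t| + #|porbits (s * t)%g| <= #|T| + #|L @: T|.*2].
Proof.
have [k] := ubnP (#|T| - #|porbits s|); elim: k s => // k IH s sk.
have le_s (u : {perm T}) : #|porbits u| <= #|T| by exact: leq_imset_card.
case: (altP (s =P 1%g)) => [->|s1].
  have repr x : exists y, porbit t x == porbit t y by exists x.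
  pose L x := xchoose (repr x).
  have LP x : porbit t (L x) = porbit t x by rewrite (eqP (xchooseP (repr x))).
  have Leq x y : porbit t x = porbit t y -> L x = L y.
    by move=> txy; apply: eq_xchoose => z; rewrite txy.
  exists L; split=> [x|x|].
  - by rewrite perm1.
  - by apply: Leq; apply/eqP; rewrite eq_porbit_mem perm_porbit.
  - rewrite mul1g card_porbits1 -addnA addnn leq_add2l leq_double.
    have -> : porbits t = (porbit t) @: (L @: T).
      rewrite -imset_comp; apply: eq_imset => x /=; exact: esym (LP x).
    exact: leq_imset_card.
have [x sx] : exists x, s x != x.
  apply/existsP; apply: contraNT s1; rewrite negb_exists => /forallP sE.
  by apply/eqP/permP => x; rewrite perm1; apply/eqP/negbNE/sE.
pose y := s x; pose s' : {perm T} := (tperm x y * s)%g.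
have xy : x != y by rewrite eq_sym.
have s'n : #|porbits s'| = #|porbits s|.+1.
  by apply: card_porbits_cut => //; exact: perm_porbit.
have sE : s = (tperm x y * s')%g by rewrite mulgA tperm2 mul1g.
have [|L [Ls' Lt leL]] := IH s'; first by move: sk (le_s s'); lia.
have sE' z : s z = s' (tperm x y z) by rewrite {1}sE permM.
case: (altP (L x =P L y)) => [Lxy|Lxy].
  (* The cut did not separate the labels: [L] remains valid. *)
  exists L; split=> // [z|].
    by rewrite sE' Ls'; case: tpermP => // ->.
  have e : #|porbits (s * t)%g| <= #|porbits (s' * t)%g|.+1.
    have := porbits_mul_tperm (s' * t)%g x y; rewrite /= xy addn1 mulgA -sE => <-.
    exact: leq_addr.
  by move: leL e; rewrite s'n; lia.
(* The labels of [x] and [y] are merged, while [s t] loses a cycle. *)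
pose L' z := if L z == L y then L x else L z.
exists L'; split=> [z|z|].
- rewrite sE' /L' Ls'; case: tpermP => [->|->|//]; first by rewrite eqxx (negbTE Lxy).
  by rewrite eqxx (negbTE Lxy).
- by rewrite /L' Lt.
- have nxy : y \notin porbit (s' * t)%g x.
    apply: contra Lxy => /(@porbit_invariant _ L) -> // z.
    by rewrite permM Lt Ls'.
  have j : #|porbits (s' * t)%g| = #|porbits (s * t)%g|.+1.
    by rewrite (card_porbits_join nxy) mulgA -sE.
  have le2 : #|L @: T| <= #|L' @: T|.+1.
    rewrite (cardsD1 (L y)) imset_f //= add1n ltnS; apply: subset_leq_card.
    apply/subsetP => u; rewrite !inE => /andP[uy /imsetP[z _ uz]].
    by apply/imsetP; exists z => //; rewrite /L' -uz (negbTE uy).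
  move: leL; rewrite s'n; lia.
Qed.

Lemma euler_connected s t :
  (forall L : T -> T, (forall x, L (s x) = L x) -> (forall x, L (t x) = L x) ->
     forall x y, L x = L y) ->
  #|porbits s| + #|porbits t| + #|porbits (s * t)%g| <= #|T| + 2.
Proof.
move=> conn; have [L [Ls Lt]] := euler_labelling s t.
move=> /leq_trans; apply; rewrite leq_add2l -[2]/(1.*2) leq_double.
case: (pickP (@predT T)) => [x _|noT].
  rewrite -(cards1 (L x)); apply: subset_leq_card; apply/subsetP => _ /imsetP[y _ ->].
  by rewrite inE (conn L Ls Lt y x).
rewrite (@leq_trans 0) // leqn0 cards_eq0; apply/eqP/setP => u.
by rewrite inE; apply/imsetP => -[x]; have := noT x.
Qed.

Lemma porbits1P g : #|porbits g| = 1 -> forall x y, y \in porbit g x.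
Proof.
move=> /eqP/cards1P[B gB] x y; rewrite -eq_porbit_mem.
have gP z : porbit g z = B by apply/set1P; rewrite -gB imset_f.
by rewrite !gP.
Qed.

Lemma euler_cycle s g : #|porbits g| = 1 ->
  #|porbits s| + #|porbits (s^-1 * g)%g| <= #|T|.+1.
Proof.
move=> g1; have := @euler_connected s (s^-1 * g)%g.
rewrite mulgA mulgV mul1g g1 addn2 addn1 ltnS; apply => L Ls Lsg x y.
apply: (porbit_invariant _ (porbits1P g1 y x)) => z.
by rewrite -(Ls z) -[in RHS]Lsg permM permK.
Qed.

(** Equality in [euler_cycle]: the pair formed by [s] and the one-cycle
    permutation [g] glues to a sphere. *)
Definition genus0 g s := #|porbits s| + #|porbits (s^-1 * g)%g| == #|T|.+1.

(** Cutting [s] and [g] by the same transposition leaves s^-1 g unchanged.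
    If [c] and [d] were joined by the cut [s] but separated by the cut [g], a second
    transposition would cut [s] once more and reconnect [g] into one cycle; [s] would
    have gained two cycles, against [euler_cycle]. *)
Lemma genus0_cut_cycle g s a b c d : #|porbits g| = 1 -> genus0 g s ->
  a != b -> b \in porbit s a -> d \in porbit (tperm a b * s)%g c ->
  d \in porbit (tperm a b * g)%g c.
Proof.
move=> g1 /eqP s0 ab sab scd; apply: contraT => gcd.
have cd : c != d by apply: contraNneq gcd => ->; exact: porbit_id.
have ga := card_porbits_cut ab (porbits1P g1 a b).
have gc := card_porbits_join gcd.
have sa := card_porbits_cut ab sab.
have sc := card_porbits_cut cd scd.
have g1' : #|porbits (tperm c d * (tperm a b * g)%g)| = 1 by lia.
have := euler_cycle (tperm c d * (tperm a b * s)%g) g1'.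
have -> : ((tperm c d * (tperm a b * s))^-1 * (tperm c d * (tperm a b * g)) =
           s^-1 * g :> {perm T})%g.
  rewrite !invMg !tpermV -!mulgA (mulgA (tperm c d) (tperm c d)) tperm2 mul1g.
  by rewrite (mulgA (tperm a b) (tperm a b)) tperm2 mul1g.
by rewrite sc sa -s0 !addSn ltnNge leqnSn.
Qed.

Lemma porbit_avoid s a b x y : a \notin porbit s x -> b \notin porbit s x ->
  y \in porbit s x -> y \in porbit (tperm a b * s)%g x.
Proof.
move=> ax bx /porbitP[k ->]; apply/porbitP; exists k.
elim: k => [|k IH]; first by rewrite !expg0.
rewrite !expgSr !permM -IH tpermD //.
  by apply: contraNneq ax => ->; exact: mem_porbit.
by apply: contraNneq bx => ->; exact: mem_porbit.
Qed.

Lemma porbit_tperm_sub s a b x y : b \in porbit s a ->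
  y \in porbit (tperm a b * s)%g x -> y \in porbit s x.
Proof.
move=> ab /(@porbit_invariant _ (porbit s)) h; rewrite -eq_porbit_mem h // => z.
rewrite permM; apply/eqP; rewrite eq_porbit_mem.
apply: porbit_trans (perm_porbit s _).
by case: tpermP => [->|->|_ _] //; rewrite ?porbit_id // porbit_sym.
Qed.

Lemma tperm_next s x : (tperm x (s x) * s)%g (s x) = s x.
Proof. by rewrite permM tpermR. Qed.

Lemma porbit_fix s x y : s x = x -> y \in porbit s x -> y = x.
Proof.
move=> sx /porbitP[k ->]; elim: k => [|k IH]; first by rewrite expg0 perm1.
by rewrite expgSr permM IH.
Qed.

(** The transposition of [x] and [s x] removes [s x] from its cycle and fixes it,
    and it does not change the rest of the cycle. *)
Lemma porbit_skip s x u v : u != s x -> v != s x -> v \in porbit s u ->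
  v \in porbit (tperm x (s x) * s)%g u.
Proof.
set z := s x; set s' := (_ * s)%g => uz vz /porbitP[k vE].
have zfix : s' z = z by exact: tperm_next.
(* An iterate of [s] may sit at the skipped point [z], but then it came from [x]. *)
have [//|[vz']] : v \in porbit s' u \/ v = z /\ x \in porbit s' u.
  2: by rewrite vz' eqxx in vz.
rewrite {}vE {v vz}; elim: k => [|k [IH|[IH1 IH2]]].
- by left; rewrite expg0 perm1 porbit_id.
- rewrite expgSr permM; move: IH; move: ((s ^+ k)%g u) => w IH.
  case: (altP (w =P x)) => [wx|wx]; first by right; rewrite -wx; split=> //; rewrite wx.
  have wz : w != z.
    by apply: contraNneq uz => wz; move: IH; rewrite wz porbit_sym => /(porbit_fix zfix) ->.
  left; apply: porbit_trans IH _.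
  suff -> : s w = s' w by exact: perm_porbit.
  by rewrite permM tpermD // eq_sym.
- left; rewrite expgSr permM IH1; apply: porbit_trans IH2 _.
  suff -> : s z = s' x by exact: perm_porbit.
  by rewrite permM tpermL.
Qed.

End Cycles.

(** * Genus zero permutations and non-crossing partitions *)

Section Noncrossing.
Variable n : nat.
Implicit Types (s : {perm 'I_n}) (x y z : 'I_n) (p : {set {set 'I_n}}).

Definition cyc : {perm 'I_n} := perm (@ordS_inj n).

Lemma cycE x : cyc x = (if x.+1 == n then 0 else x.+1) :> nat.
Proof.
rewrite permE /=; case: eqP => [->|/eqP xn]; first by rewrite modnn.
by rewrite modn_small // ltn_neqAle xn ltn_ord.
Qed.

Lemma cyc_connected x y : y \in porbit cyc x.
Proof.
have from0 k (z w : 'I_n) : z = 0 :> nat -> w = k :> nat -> w \in porbit cyc z.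
  elim: k w => [|k IH] w z0 wk.
    by rewrite (_ : w = z) ?porbit_id //; apply: val_inj; rewrite /= z0 wk.
  have kn : k < n by rewrite ltnW // -wk ltn_ord.
  apply: (porbit_trans (IH (Ordinal kn) z0 erefl)).
  rewrite (_ : w = cyc (Ordinal kn)) ?perm_porbit //; apply: val_inj.
  by rewrite /= cycE /= -wk ltn_eqF.
have n0 : 0 < n by apply: leq_ltn_trans (ltn_ord x).
have := from0 x (Ordinal n0) x erefl erefl; rewrite porbit_sym => x0.
exact: porbit_trans x0 (from0 y (Ordinal n0) y erefl erefl).
Qed.

Lemma card_porbits_cyc : 0 < n -> #|porbits cyc| = 1.
Proof.
move=> n0; apply/eqP/cards1P; exists setT; apply/setP => B; rewrite inE.
apply/imsetP/eqP => [[x _ ->]|->].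
  by apply/setP => y; rewrite inE cyc_connected.
by exists (Ordinal n0) => //; apply/setP => y; rewrite inE cyc_connected.
Qed.

(** The transposition cuts the long cycle into the interval ]a, b] and its
    complement. *)
Lemma porbit_cut_cyc (a b c d : 'I_n) : a < b ->
  d \in porbit (tperm a b * cyc)%g c -> (a < d <= b) = (a < c <= b).
Proof.
move=> ab; apply: (@porbit_invariant _ _ (fun z : 'I_n => a < z <= b)) => z.
rewrite permM cycE; have bn := ltn_ord b.
case: tpermP => [->|->|za zb].
- by case: eqP => e; lia.
- by case: eqP => e; lia.
- have {}za : z <> a :> nat by move=> /val_inj.
  have {}zb : z <> b :> nat by move=> /val_inj.
  by have zn := ltn_ord z; case: eqP => e; lia.
Qed.

(** [s] maps every point to the next point of its cycle, in the cyclic order of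
    ['I_n]; the two branches say this with the linear order. *)
Definition block_succ s := forall x y, y \in porbit s x ->
  if x < s x then (y <= x) || (s x <= y) else s x <= y <= x.

Definition planar s := forall i j k l : 'I_n, i < j -> j < k -> k < l ->
  k \in porbit s i -> l \in porbit s j -> j \in porbit s i.

(** A point [y] of the cycle strictly between [x] and [s x] would stay with [x]
    in [s] cut at [x] and [s x], but not in the long cycle cut at the same points. *)
Lemma genus0_block_succ s : 0 < n -> genus0 cyc s -> block_succ s.
Proof.
move=> n0 s0 x y sxy; have c1 := card_porbits_cyc n0.
have [sxx|sxx] := eqVneq (s x) x.
  by rewrite (porbit_fix sxx sxy) sxx ltnn leqnn.
have [->|ysx] := eqVneq y (s x); first by case: ltnP; lia.
have sy : y \in porbit (tperm x (s x) * s)%g x.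
  by apply: porbit_skip => //; rewrite eq_sym.
have cy : y \in porbit (tperm x (s x) * cyc)%g x.
  by apply: genus0_cut_cycle c1 s0 _ _ sy; rewrite ?perm_porbit // eq_sym.
move: sxx ysx; rewrite -!val_eqE /= => sxx ysx.
case: (ltnP x (s x)) => [lt|ge].
  by have := porbit_cut_cyc lt cy; lia.
rewrite tpermC in cy; have lt : s x < x by lia.
by have := porbit_cut_cyc lt cy; lia.
Qed.

(** Two crossing cycles would contradict [genus0_cut_cycle] with the cut made
    in one of them. *)
Lemma genus0_planar s : 0 < n -> genus0 cyc s -> planar s.
Proof.
move=> n0 s0 i j k l ij jk kl sik sjl; apply: contraT => sij.
have ik : i != k by rewrite -val_eqE /=; lia.
have sl : l \in porbit (tperm i k * s)%g j.
  apply: porbit_avoid => //; first by rewrite porbit_sym.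
  apply: contra sij => sjk; apply: porbit_trans sik _.
  by rewrite porbit_sym.
have cl := genus0_cut_cycle (card_porbits_cyc n0) s0 ik sik sl.
by have := porbit_cut_cyc (ltn_trans ij jk) cl; lia.
Qed.

Lemma block_succ_inj s t : block_succ s -> block_succ t ->
  porbits s = porbits t -> s = t.
Proof.
move=> sS tS st.
have stE x : porbit s x = porbit t x.
  have : porbit s x \in porbits t by rewrite -st imset_f.
  case/imsetP => y _ e; rewrite e; apply/eqP.
  by rewrite eq_porbit_mem porbit_sym -e porbit_id.
apply/permP => x; apply: val_inj => /=.
have := sS x (t x); rewrite stE perm_porbit => /(_ isT).
have := tS x (s x); rewrite -stE perm_porbit => /(_ isT).
by case: ltnP => ?; case: ltnP => ?; lia.
Qed.

Lemma card_moved_skip s x : s x != x ->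
  #|[set y | (tperm x (s x) * s)%g y != y]| < #|[set y | s y != y]|.
Proof.
move=> sx; apply: proper_card; apply/properP; split.
  apply/subsetP => y; rewrite !inE; apply: contraNneq => sy.
  have yx : x != y by apply: contraNneq sx => ->; rewrite sy.
  have ysx : s x != y.
    by apply: contraNneq yx => e; apply/eqP; apply: (@perm_inj _ s); rewrite e sy.
  by rewrite permM tpermD // sy.
exists (s x); rewrite !inE ?tperm_next ?eqxx //.
by rewrite (inj_eq perm_inj).
Qed.

(** The induction removes one point from a cycle.  Among the points [x] with
    x < s x one with the smallest gap is chosen: since cycles do not cross and each
    point goes to its successor, every point strictly between [x] and [z = s x] is
    then fixed.  After the removal of [z] from its cycle, the permutation s'^-1 cyc
    therefore walks step by step from s' x to [z], so that restoring [z] cuts this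
    cycle and loses one cycle of [s']: the total count is unchanged. *)
Lemma block_succ_genus0 s : 0 < n -> block_succ s -> planar s -> genus0 cyc s.
Proof.
move=> n0; have [m] := ubnP #|[set y | s y != y]|; elim: m s => // m IH s sm sS sP.
have [->|s1] := eqVneq s 1%g.
  by rewrite /genus0 card_porbits1 invg1 mul1g card_porbits_cyc // addn1.
have up y : y != s y -> exists2 w, w \in porbit s y & w < s w.
  move=> ysy; case: (ltnP y (s y)) => [lt|ge]; first by exists y; rewrite ?porbit_id.
  have lt : s y < y by rewrite ltn_neqAle ge andbT eq_sym.
  exists (s y); first exact: perm_porbit.
  rewrite ltnNge; apply: contraL lt => le; have := sS (s y) y.
  by rewrite porbit_sym perm_porbit => /(_ isT); rewrite ltnNge le /= -leqNgt => /andP[].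
have [x0 ltx0] : exists x, x < s x.
  have [y sy] : exists y, y != s y.
    apply/existsP; apply: contraNT s1; rewrite negb_exists => /forallP sE.
    by apply/eqP/permP => x; rewrite perm1; apply/esym/eqP/negbNE/sE.
  by have [w _ lt] := up y sy; exists w.
have [x ltx xmin] : exists2 x : 'I_n, x < s x &
    forall v : 'I_n, v < s v -> s x - x <= s v - v.
  have [x ltx xmin] := @arg_minnP _ x0 (fun x => x < s x) (fun x => s x - x) ltx0.
  by exists x.
set z := s x in ltx xmin.
(* A moved point of ]x, z[ would have its cycle inside, with a smaller gap in it. *)
have fixed (w : 'I_n) : x < w -> w < z -> s w = w.
  move=> xw wz; apply/eqP; apply: contraT => sw.
  have nsw : w \notin porbit s x.
    by apply/negP => /sS; rewrite -/z ltx; lia.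
  have inside (u : 'I_n) : u \in porbit s w -> x < u < z.
    move=> su; have [ux|xu|/val_inj ux] := ltngtP u x.
    - have swu : w \in porbit s u by rewrite porbit_sym.
      have sux := sP u x w z ux xw wz swu (perm_porbit s x).
      by case/negP: nsw; apply: porbit_trans swu; rewrite porbit_sym.
    - have [//|zu|/val_inj uz] := ltngtP u z.
        by case/negP: nsw; exact: sP xw wz zu (perm_porbit s x) su.
      by case/negP: nsw; rewrite porbit_sym (porbit_trans su) // uz porbit_sym perm_porbit.
    - by case/negP: nsw; rewrite porbit_sym -ux.
  have [v svw ltv] : exists2 v, v \in porbit s w & v < s v.
    by apply: up; rewrite eq_sym.
  have := inside _ svw; have := inside (s v); rewrite (porbit_trans svw) ?perm_porbit //.
  by move=> /(_ isT); have := xmin v ltv; lia.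
pose s' := (tperm x z * s)%g : {perm 'I_n}.
have xz : x != z by rewrite -val_eqE /= ltn_eqF.
have zx : z != x by rewrite eq_sym.
have s'z : s' z = z by exact: tperm_next.
have s'x : s' x = s z by rewrite permM tpermL.
have s'D u : u != x -> u != z -> s' u = s u.
  by move=> ux uz; rewrite permM tpermD // eq_sym.
have s'sub u v : v \in porbit s' u -> v \in porbit s u.
  by apply: porbit_tperm_sub; exact: perm_porbit.
have s'S : block_succ s'.
  move=> u y s'y; have sy := s'sub _ _ s'y.
  have [uz|uz] := eqVneq u z.
    by rewrite uz in s'y *; rewrite (porbit_fix s'z s'y) s'z ltnn leqnn.
  have yz : y != z.
    apply: contraNneq uz => yz; move: s'y; rewrite porbit_sym yz.
    by move/(porbit_fix s'z) ->.
  have [ux|ux] := eqVneq u x; last by rewrite s'D //; exact: sS.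
  rewrite ux in sy *; rewrite s'x.
  have sxz : x \in porbit s z by rewrite porbit_sym perm_porbit.
  have := sS z x sxz; have := sS z y (porbit_trans sxz sy); have := sS x y sy.
  rewrite -/z ltx => h1 h2 h3.
  by move: yz h1 h2; rewrite -val_eqE /=; case: ltnP => ?; case: ltnP => ?; lia.
have s'P : planar s'.
  move=> i j k l ij jk kl s'ik s'jl.
  have nz u v : u != v -> v \in porbit s' u -> (u != z) && (v != z).
    move=> uv s'uv; apply/andP; split; apply: contraNneq uv => e.
      by rewrite e in s'uv *; rewrite (porbit_fix s'z s'uv).
    by rewrite e porbit_sym in s'uv *; rewrite (porbit_fix s'z s'uv).
  have /andP[iz _] : (i != z) && (k != z) by apply: nz => //; rewrite -val_eqE /=; lia.
  have /andP[jz _] : (j != z) && (l != z) by apply: nz => //; rewrite -val_eqE /=; lia.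
  apply: porbit_skip => //.
  by apply: sP ij jk kl _ _; exact: s'sub.
have s'm : #|[set y | s' y != y]| < m.
  by rewrite (leq_trans _ (ltnSE sm)) //; apply: card_moved_skip.
have /eqP s'0 := IH s' s'm s'S s'P.
have cutE : #|porbits s'| = #|porbits s|.+1.
  by apply: card_porbits_cut => //; exact: perm_porbit.
pose r' := (s'^-1 * cyc)%g : {perm 'I_n}.
have rE : (s^-1 * cyc)%g = (tperm (s' x) z * r')%g.
  have -> : tperm (s' x) z = ((tperm x z) ^ s')%g by rewrite tpermJ s'z.
  rewrite /r' conjgE -!mulgA (mulgA (tperm x z)) tperm2 mul1g /s' invMg tpermV.
  by rewrite -!mulgA mulKVg (mulgA (tperm x z)) tperm2 mul1g.
(* The points between [x] and [z] being fixed, [r'] acts there as the successor. *)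
have along k : 0 < k -> k <= z - x -> (r' ^+ k)%g (s' x) = x + k :> nat.
  have zn := ltn_ord z.
  elim: k => // -[|k] IHk _ kz.
    by rewrite expg1 permM permK cycE ifN; lia.
  have {}IHk := IHk isT (ltnW kz).
  rewrite expgSr permM; set w := (r' ^+ _)%g _ in IHk *.
  have wE : s' w = w.
    by rewrite s'D ?fixed // -?val_eqE /= IHk; lia.
  by rewrite permM -{1}wE permK cycE IHk ifN; lia.
have s'xz : s' x != z by rewrite s'x (inj_eq perm_inj).
have cutr : #|porbits (s^-1 * cyc)%g| = #|porbits r'|.+1.
  rewrite rE; apply: card_porbits_cut => //.
  apply/porbitP; exists (z - x); apply: val_inj => /=.
  by rewrite along; lia.
apply/eqP; move: s'0; rewrite -/r' cutE cutr; lia.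
Qed.

End Noncrossing.

Section NCbij.
Variable n : nat.
Implicit Types (s : {perm 'I_n}) (x y z : 'I_n) (p : {set {set 'I_n}}).

Lemma porbits_partition s : partition (porbits s) [set: 'I_n].
Proof.
apply/and3P; split.
- apply/eqP/setP => x; rewrite inE; apply/bigcupP.
  by exists (porbit s x); rewrite ?imset_f ?porbit_id.
- apply/trivIsetP => _ _ /imsetP[x _ ->] /imsetP[y _ ->] xy.
  rewrite -setI_eq0; apply: contraNT xy => /set0Pn[z /setIP[zx zy]].
  by move: zx zy; rewrite -!eq_porbit_mem => /eqP <- .
- by apply/imsetP => -[x _ e]; have := porbit_id s x; rewrite -e inE.
Qed.

Lemma planar_noncrossing s : planar s <-> noncrossing (porbits s).
Proof.
split=> [sP|sN].
  apply/forall_inP => _ /imsetP[x _ ->]; apply/forall_inP => _ /imsetP[y _ ->].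
  apply/forall_inP => i xi; apply/forall_inP => j yj.
  apply/forall_inP => k xk; apply/forall_inP => l yl.
  apply/implyP => /and3P[ij jk kl].
  have xiE : porbit s i = porbit s x by apply/eqP; rewrite eq_porbit_mem.
  have yjE : porbit s j = porbit s y by apply/eqP; rewrite eq_porbit_mem.
  rewrite -xiE -yjE eq_sym eq_porbit_mem.
  by apply: sP ij jk kl _ _; rewrite ?xiE ?yjE.
move=> i j k l ij jk kl sik sjl.
move/forall_inP/(_ (porbit s i) (imset_f _ _)): sN => /(_ isT).
move/forall_inP/(_ (porbit s j) (imset_f _ _)) => /(_ isT).
move/forall_inP/(_ i (porbit_id s i))/forall_inP/(_ j (porbit_id s j)).
move/forall_inP/(_ k sik)/forall_inP/(_ l sjl).
by rewrite ij jk kl /= eq_sym eq_porbit_mem.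
Qed.

Lemma next_sorted (c : seq 'I_n) x y : sorted ltn (map val c) ->
    x \in c -> y \in c ->
  if x < next c x then (y <= x) || (next c x <= y) else next c x <= y <= x.
Proof.
case: c => // y0 c' srt xc yc; set c := y0 :: c' in srt xc yc *.
have lt_nth i j : i < j -> j < size c -> nth y0 c i < nth y0 c j.
  move=> ij jc; have ic := ltn_trans ij jc.
  have := sorted_ltn_nth ltn_trans 0 srt; rewrite /prop_in2 => /(_ i j).
  by rewrite !inE size_map (nth_map y0) // (nth_map y0) //; apply.
have le_nth i j : i <= j -> j < size c -> nth y0 c i <= nth y0 c j.
  by rewrite leq_eqVlt => /predU1P[->//|ij jc]; rewrite ltnW // lt_nth.
rewrite next_nth xc /=; move: (xc) (yc); rewrite -!index_mem.
set k := index x c; set m := index y c => kc mc.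
have xE : x = nth y0 c k by rewrite nth_index.
have yE : y = nth y0 c m by rewrite nth_index.
case: (ltnP k (size c')) => kc'.
  have nE : nth y0 c' k = nth y0 c k.+1 by [].
  have xn : x < nth y0 c k.+1 by rewrite {1}xE lt_nth.
  rewrite nE xn; case: (leqP m k) => mk; apply/orP.
    by left; have := le_nth m k mk kc; rewrite -xE -yE.
  by right; have := le_nth k.+1 m mk mc; rewrite -yE.
rewrite nth_default //.
have y0x : y0 <= x by have := le_nth 0 k (leq0n _) kc; rewrite -xE.
have y0y : y0 <= y by have := le_nth 0 m (leq0n _) mc; rewrite -yE.
have mk : m <= k by move: mc kc'; rewrite /=; lia.
have yx : y <= x by have := le_nth m k mk kc; rewrite -xE -yE.
by rewrite ltnNge y0x y0y yx.
Qed.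

(** On each block the permutation is [next] along the increasing enumeration. *)
Lemma block_succ_exists p : partition p [set: 'I_n] ->
  exists2 s, block_succ s & porbits s = p.
Proof.
move=> pP; have pT x : x \in cover p by rewrite (cover_partition pP) inE.
have pblk x : pblock p x \in p by exact: pblock_mem.
have memp x : x \in pblock p x by rewrite mem_pblock.
pose c x := enum (pblock p x).
have c_mem x y : (y \in c x) = (y \in pblock p x) by rewrite mem_enum.
have cx x y : y \in c x -> c y = c x.
  rewrite c_mem => xy; rewrite /c (same_pblock _ xy) //; by case/and3P: pP.
have uc x : uniq (c x) by exact: enum_uniq.
pose f x := next (c x) x.
have f_mem x : f x \in c x by rewrite mem_next c_mem.
have f_inj : injective f.
  move=> x y fxy; have cxy : c x = c y by rewrite -(cx x (f x)) ?f_mem // fxy (cx y (f y)).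
  by apply: (can_inj (prev_next (uc x))); rewrite -/(f x) fxy /f cxy.
pose s := perm f_inj.
have sE x : s x = f x by rewrite permE.
have orbE x : porbit s x = pblock p x.
  apply/setP => y; apply/idP/idP.
    rewrite -c_mem => /(@porbit_invariant _ _ c) cyx.
    rewrite -cyx ?c_mem // => z; rewrite sE; exact: cx.
  rewrite -c_mem => xy.
  have fc : fcycle s (c x).
    have := cycle_next (uc x); apply: sub_in_cycle (allss _) => u v ux _ /=.
    by rewrite sE /f (cx x u ux).
  have := fconnect_cycle fc (_ : x \in c x) y; rewrite xy c_mem memp => /(_ isT).
  by move=> /iter_findex <-; rewrite -permX mem_porbit.
exists s.
  move=> x y; rewrite orbE -c_mem sE /f.
  have srt : sorted ltn (map val (c x)).
    rewrite /c /enum_mem -enumT.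
    apply: (subseq_sorted ltn_trans (map_subseq val (filter_subseq _ _))).
    by rewrite val_enum_ord iota_ltn_sorted.
  by apply: next_sorted => //; rewrite c_mem.
apply/setP => B; apply/imsetP/idP => [[x _ ->]|pB]; first by rewrite orbE.
have /set0Pn[x xB] : B != set0 by apply: contraTneq pB => ->; case/and3P: pP.
by exists x => //; rewrite orbE; apply/esym/def_pblock; case/and3P: pP.
Qed.

Lemma porbits_genus0_inj : 0 < n ->
  {in [set s | genus0 (cyc n) s] &, injective (fun s : {perm 'I_n} => porbits s)}.
Proof.
move=> n0 s t; rewrite !inE => s0 t0.
by apply: block_succ_inj; exact: genus0_block_succ.
Qed.

Lemma NC_genus0 : 0 < n ->
  NC n = (fun s : {perm 'I_n} => porbits s) @: [set s | genus0 (cyc n) s].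
Proof.
move=> n0; apply/setP => p; rewrite inE; apply/andP/imsetP => [[pP pN]|].
  have [s sS sp] := block_succ_exists pP; exists s => //; rewrite inE.
  by apply: block_succ_genus0 => //; apply/planar_noncrossing; rewrite sp.
move=> [s]; rewrite inE => s0 ->; split; first exact: porbits_partition.
exact/planar_noncrossing/genus0_planar.
Qed.

Lemma big_NC (R : Type) (idx : R) (op : Monoid.com_law idx) (F : nat -> R) : 0 < n ->
  \big[op/idx]_(p in NC n) F #|p| =
  \big[op/idx]_(s : {perm 'I_n} | genus0 (cyc n) s) F #|porbits s|.
Proof.
move=> n0; rewrite NC_genus0 // big_imset; last exact: porbits_genus0_inj.
by apply: eq_bigl => s; rewrite inE.
Qed.

End NCbij.

(** * Counting with pairings *)

Lemma is_pairingP (T : finType) (p : {perm T}) :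
  reflect (forall x, p x != x /\ p (p x) = x) (is_pairing p).
Proof.
apply: (iffP forall_inP) => [pP x|pP _ /imsetP[x _ ->]].
  have /eqP p2 := pP _ (imset_f (porbit p) (isT : x \in T)).
  have := iter_porbit p x; rewrite p2 /= => ppx; split=> //.
  apply: contra_eq_neq p2 => px.
  suff -> : porbit p x = [set x] by rewrite cards1.
  by apply/setP => y; rewrite inE; apply/idP/eqP => [/(porbit_fix px)|->]; rewrite ?porbit_id.
have [px ppx] := pP x.
suff -> : porbit p x = [set x; p x] by rewrite cards2 (eq_sym x) px.
apply/setP => y; rewrite !inE; apply/idP/orP => [/porbitP[k ->]|[]/eqP->].
- elim: k => [|k IH]; first by left; rewrite expg0 perm1.
  by rewrite expgSr permM; case: IH => /eqP ->; [right|left; rewrite ppx].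
- exact: porbit_id.
- exact: perm_porbit.
Qed.

(** Functions constant on the fibres of [J] are the functions on its image. *)
Lemma card_factor (T K U : finType) (J : T -> U) :
  #|[set u : {ffun T -> K} | [forall x, forall y, (J x == J y) ==> (u x == u y)]]| =
  #|K| ^ #|J @: T|.
Proof.
pose I := {y | y \in J @: T}.
have JP x : J x \in J @: T by exact: imset_f.
have exJ (y : I) : exists x, J x == val y.
  by have /imsetP[x _ ->] := valP y; exists x.
pose G (v : {ffun I -> K}) := [ffun x => v (exist _ (J x) (JP x))].
have G_inj : injective G.
  move=> v w /ffunP vw; apply/ffunP => -[y yP]; have /imsetP[x _ yx] := yP.
  by have := vw x; rewrite !ffunE; congr (v _ = w _); apply: val_inj.
transitivity #|G @: [set: {ffun I -> K}]|.
  congr #|pred_of_set _|; apply/setP => u; rewrite inE; apply/forallP/imsetP.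
    move=> uP; exists [ffun y : I => u (xchoose (exJ y))] => //.
    apply/ffunP => x; rewrite !ffunE; apply/eqP/(implyP (forallP (uP _) _)).
    by rewrite eq_sym (xchooseP (exJ _)).
  move=> [v _ ->] x; apply/forallP => y; apply/implyP => /eqP xy; rewrite !ffunE.
  by apply/eqP; congr (v _); apply: val_inj.
by rewrite card_imset // cardsT card_ffun card_sig; congr (_ ^ _).
Qed.

Section Pairings.
Variables (T : finType) (p q : {perm T}).
Hypotheses (pP : is_pairing p) (qP : is_pairing q).
Let r : {perm T} := (p * q)%g.

Let pfree x : p x != x. Proof. by have /is_pairingP/(_ x)[] := pP. Qed.
Let pK x : p (p x) = x. Proof. by have /is_pairingP/(_ x)[] := pP. Qed.
Let qfree x : q x != x. Proof. by have /is_pairingP/(_ x)[] := qP. Qed.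
Let qK x : q (q x) = x. Proof. by have /is_pairingP/(_ x)[] := qP. Qed.

Let prpr x : r (p (r x)) = p x.
Proof. by rewrite !permM pK qK. Qed.

(** Since p r p = r^-1, a relation p x = r^k x shrinks to
    p y = r^(k-2) y, and the cases k = 0 and k = 1 say that [p] or [q] has a fixed
    point. *)
Lemma pairings_orbit_free x : p x \notin porbit r x.
Proof.
apply/porbitP => -[k]; elim/ltn_ind: k x => -[|[|k]] IH x.
- by rewrite expg0 perm1 => /eqP; rewrite (negbTE (pfree x)).
- by rewrite expg1 permM => /eqP; rewrite eq_sym (negbTE (qfree (p x))).
rewrite expgSr (permM _ r) expgS (permM r) -(prpr x) => /perm_inj e.
by apply: (IH k _ (r x)).
Qed.

Let pr_orbit x : p @: porbit r x = porbit r (p x).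
Proof.
have rVp y : p (r y) = (r^-1)%g (p y).
  by apply: (@perm_inj _ r); rewrite permKV prpr.
apply/setP => y; rewrite -(porbitV r (p x)).
apply/imsetP/porbitP => [[_ /porbitP[k ->] ->]|[k ->]].
  exists k; elim: k => [|k IH]; first by rewrite !expg0 !perm1.
  by rewrite !expgSr (permM _ r) (permM _ r^-1) rVp IH.
exists ((r ^+ k)%g x); first exact: mem_porbit.
elim: k => [|k IH]; first by rewrite !expg0 !perm1.
by rewrite !expgSr (permM _ r) (permM _ r^-1) rVp IH.
Qed.

Let H (O : {set T}) := O :|: p @: O.

Let HP x y : (H (porbit r y) == H (porbit r x)) =
  (y \in porbit r x) || (y \in porbit r (p x)).
Proof.
rewrite /H !pr_orbit; apply/eqP/orP => [e|].
  by apply/orP; rewrite -in_setU -e in_setU porbit_id.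
case; rewrite -eq_porbit_mem => /eqP e; rewrite -!pr_orbit e //.
by rewrite !pr_orbit pK setUC.
Qed.

(** [p] permutes the cycles of [r] without fixing any, and the joint orbits of
    [p] and [q] are the unions of a cycle with its image. *)
Lemma card_porbits_pairings : #|porbits r| = #|(fun x => H (porbit r x)) @: T|.*2.
Proof.
have -> : (fun x => H (porbit r x)) @: T = H @: porbits r by rewrite /porbits -imset_comp.
rewrite -sum1_card (partition_big_imset H) /= -muln2 -sum_nat_const.
apply: eq_bigr => _ /imsetP[_ /imsetP[x _ ->] ->]; rewrite sum1dep_card.
suff -> : [set O in porbits r | H O == H (porbit r x)] = [set porbit r x; porbit r (p x)].
  by rewrite cards2 eq_sym eq_porbit_mem pairings_orbit_free.
apply/setP => O; rewrite !inE; apply/andP/orP => [[/imsetP[y _ ->]]|].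
  by rewrite HP -!eq_porbit_mem => /orP[]; [left|right].
by case=> /eqP ->; rewrite imset_f // HP porbit_id ?orbT.
Qed.

Lemma porbits_pairings_even : ~~ odd #|porbits r|.
Proof. by rewrite card_porbits_pairings odd_double. Qed.

(** A function is invariant under [p] and [q] when it is constant on their
    joint orbits, and there are half as many joint orbits as cycles of [r]. *)
Lemma card_pairings_invariant (K : finType) :
  #|[set u : {ffun T -> K} | [forall x, (u (p x) == u x) && (u (q x) == u x)]]| =
  #|K| ^ #|porbits r|./2.
Proof.
rewrite card_porbits_pairings doubleK -card_factor; congr #|pred_of_set _|.
apply/setP => u; rewrite !inE; apply/forallP/forallP => uP x.
  apply/forallP => y; apply/implyP; rewrite HP => xy.
  have up z : u (p z) = u z by have /andP[/eqP] := uP z.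
  have uq z : u (q z) = u z by have /andP[_ /eqP] := uP z.
  have ur z : u (r z) = u z by rewrite permM uq up.
  by case/orP: xy => /(porbit_invariant ur) ->; rewrite ?up.
apply/andP; split; apply: (implyP (forallP (uP _) x)); rewrite HP.
  by rewrite porbit_id orbT.
have -> : q x = r (p x) by rewrite permM pK.
by rewrite perm_porbit orbT.
Qed.

End Pairings.

(** * Permutations of the signed set *)

Section Signed.
Variable n : nat.
Implicit Types (a b : {perm 'I_n}) (s : {perm pm n}).

Definition signed_fun a b (x : pm n) : pm n :=
  (x.1, if x.1 then a x.2 else b x.2).

Lemma signed_fun_inj a b : injective (signed_fun a b).
Proof. by move=> [[] i] [[] j] //= [] /perm_inj ->. Qed.

Definition signed a b : {perm pm n} := perm (@signed_fun_inj a b).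

Lemma signedE a b e i : signed a b (e, i) = (e, if e then a i else b i).
Proof. by rewrite permE. Qed.

Lemma signedM a b c d : (signed a b * signed c d = signed (a * c) (b * d))%g.
Proof. by apply/permP => -[[] i]; rewrite permM !signedE permM. Qed.

Lemma signedV a b : ((signed a b)^-1 = signed a^-1 b^-1)%g.
Proof.
apply/eqP; rewrite eq_invg_mul signedM !mulgV; apply/eqP.
by apply/permP => -[[] i]; rewrite signedE !perm1.
Qed.

Lemma signed_inj a b c d : signed a b = signed c d -> a = c.
Proof. by move=> /permP e; apply/permP => i; have := e (true, i); rewrite !signedE => -[]. Qed.

Lemma card_porbits_signed a b :
  #|porbits (signed a b)| = #|porbits a| + #|porbits b|.
Proof.
have expE k e i : (signed a b ^+ k)%g (e, i) = (e, ((if e then a else b) ^+ k)%g i).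
  elim: k => [|k IH]; first by rewrite !expg0 !perm1.
  by rewrite !expgSr !permM IH signedE; case: e {IH}.
have orbE e i : porbit (signed a b) (e, i) = [set (e, j) | j in porbit (if e then a else b) i].
  apply/setP => y; apply/porbitP/imsetP => [[k ->]|[_ /porbitP[k ->] ->]].
    by rewrite expE; eexists; last reflexivity; exact: mem_porbit.
  by exists k; rewrite expE.
pose h e (B : {set 'I_n}) : {set pm n} := [set (e, j) | j in B].
have h_inj e : injective (h e) by apply: imset_inj => i j [].
have -> : porbits (signed a b) = h true @: porbits a :|: h false @: porbits b.
  apply/setP => B; rewrite inE.
  apply/imsetP/orP => [[[[] i] _ ->]|[] /imsetP[_ /imsetP[i _ ->] ->]].
  - by left; rewrite orbE; apply/imset_f/imset_f.
  - by right; rewrite orbE; apply/imset_f/imset_f.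
  - by exists (true, i); rewrite ?orbE.
  - by exists (false, i); rewrite ?orbE.
rewrite cardsU (card_imset _ (h_inj true)) (card_imset _ (h_inj false)).
rewrite (_ : _ :&: _ = set0) ?cards0 ?subn0 //.
apply/setP => B; rewrite !inE; apply/andP => -[/imsetP[_ /imsetP[i _ ->] ->]].
move=> /imsetP[_ /imsetP[j _ ->] /setP/(_ (true, i))].
rewrite imset_f ?porbit_id // => /esym/imsetP[k _]; by case.
Qed.

Lemma deltaE e i : delta n (e, i) = (~~ e, i).
Proof. by rewrite permE. Qed.

Lemma gammat_signed : gammat n = signed (cyc n) (cyc n)^-1%g.
Proof.
have gV i : (gamma n)^-1%g (false, i) = (false, i).
  by apply: (@perm_inj _ (gamma n)); rewrite permKV permE.
have gVt i : (gamma n)^-1%g (true, i) = (true, (cyc n)^-1%g i).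
  apply: (@perm_inj _ (gamma n)); rewrite permKV permE /= /gamma_fun /=.
  by rewrite -[ordS _](permE (@ordS_inj n)) permKV.
apply/permP => -[[] i]; rewrite /gammat !permM deltaE signedE /=.
  by rewrite gV deltaE /= permE /gamma_fun /= permE.
by rewrite gVt deltaE /= permE.
Qed.

Lemma delta_pairing : is_pairing (delta n).
Proof. by apply/is_pairingP => -[[] i]; rewrite !permE. Qed.

Lemma deltaK : (delta n * delta n = 1)%g.
Proof. by apply/permP => -[[] i]; rewrite !permE /= !permE. Qed.

Definition transitive_with s :=
  [transitive <<[set s; gammat n]>>%g, on [set: pm n] | 'P].

(** Transitivity enters Euler's inequality only through the invariant labellings. *)
Lemma transitive_invariant s (L : pm n -> pm n) : transitive_with s ->
  (forall x, L (s x) = L x) -> (forall x, L (gammat n x) = L x) ->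
  forall x y, L x = L y.
Proof.
move=> sT Ls Lg x y; have /atransP2 h := sT.
have [||g gG ->] := h x y; rewrite ?inE //.
have [m [t tP ->]] := gen_prodgP gG.
rewrite -[RHS]/(L ((\prod_(i < m) t i)%g x)).
elim: m t tP x {y h gG} => [|m IH] t tP x; first by rewrite big_ord0 perm1.
rewrite big_ord_recl permM -IH => [|i]; last exact: tP.
by have := tP ord0; rewrite !inE => /orP[] /eqP ->; rewrite ?Ls ?Lg.
Qed.

Lemma card_porbits_transitive s : 0 < n -> transitive_with s ->
  #|porbits s| + #|porbits (gammat n * s^-1)%g| <= 2 * n.
Proof.
move=> n0 sT; rewrite card_porbits_mulC.
have := @euler_connected _ s (s^-1 * gammat n)%g; rewrite mulKVg.
rewrite gammat_signed card_porbits_signed porbitsV card_porbits_cyc // -gammat_signed.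
rewrite leq_add2r card_prod card_bool card_ord; apply => L Ls Lsg.
apply: (transitive_invariant sT Ls) => x.
by rewrite -(Ls x) -[in RHS]Lsg (permM s^-1) permK.
Qed.

Lemma signed_pairing a : is_pairing (delta n * signed a a^-1%g)%g.
Proof.
by apply/is_pairingP => -[[] i]; rewrite !permM deltaE signedE deltaE signedE /= ?permK ?permKV.
Qed.

Lemma signed_not_transitive a : 0 < n -> ~~ transitive_with (signed a a^-1%g).
Proof.
move=> n0; apply/negP => sT; pose i := Ordinal n0.
pose L (x : pm n) : pm n := (x.1, i).
suff /(congr1 fst) : L (true, i) = L (false, i) by [].
apply: (transitive_invariant sT) => -[e j]; rewrite /L.
  by rewrite signedE.
by rewrite gammat_signed signedE.
Qed.

(** [gammat] is transitive on each sign, so a single sign change under [s]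
    would connect everything. *)
Lemma not_transitive_sign s x : ~~ transitive_with s -> (s x).1 = x.1.
Proof.
pose G := <<[set s; gammat n]>>%g => nT; apply/eqP; apply: contraT => sx.
have sG : s \in G by rewrite mem_gen // !inE eqxx.
have gG : gammat n \in G by rewrite mem_gen // !inE eqxx orbT.
have rot e i j : (e, j) \in orbit 'P G (e, i).
  have jP : j \in porbit (if e then cyc n else (cyc n)^-1%g) i.
    by case: e; rewrite ?porbitV cyc_connected.
  case/porbitP: jP => k ->.
  rewrite (_ : (e, _) = 'P%act (e, i) (gammat n ^+ k)%g); first exact/mem_orbit/groupX.
  rewrite -[RHS]/((gammat n ^+ k)%g (e, i)) gammat_signed.
  elim: k => [|k IH]; first by rewrite !expg0 !perm1.
  by rewrite !expgSr !permM -IH signedE; case: (e).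
have sO y : s y \in orbit 'P G y by apply: (mem_orbit 'P y sG).
(* If the sign changes from - to +, the inverse of [s] changes it from + to -. *)
have cross : exists i j, (false, j) \in orbit 'P G (true, i).
  case: x sx (sO x) => -[] i; case: (s _) => -[] j //= _ xO.
    by exists i, j.
  by exists j, i; rewrite orbit_sym.
case: cross => i [j ij]; case/negP: nT; apply/imsetP; exists (true, i) => //.
apply/esym/setP => -[[] k]; rewrite inE ?rot //.
exact: orbit_trans (rot false j k) ij.
Qed.

(** Once [s] preserves signs, s delta being an involution forces its negative
    part to be the inverse of its positive part. *)
Lemma not_transitive_signed s : is_pairing (delta n * s)%g ->
  ~~ transitive_with s -> exists a, s = signed a a^-1%g.
Proof.
move=> /is_pairingP sp nT.
have sE e i : s (e, i) = (e, (s (e, i)).2).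
  by rewrite [LHS]surjective_pairing not_transitive_sign.
have a_inj : injective (fun i => (s (true, i)).2).
  move=> i j ij; have : s (true, i) = s (true, j) by rewrite sE ij -sE.
  by move/perm_inj => [].
pose a := perm a_inj; have aE i : s (true, i) = (true, a i) by rewrite sE permE.
exists a; apply/permP => -[[] i]; rewrite signedE ?aE //.
by have [_] := sp (false, (a^-1)%g i); rewrite !permM deltaE aE deltaE permKV.
Qed.

(** The sign-preserving permutations have both cycle counts doubled, so the
    halves are the cycle counts of the positive part. *)
Lemma big_pairings (R : Type) (idx : R) (op : Monoid.com_law idx) (F : nat -> nat -> R) :
  0 < n ->
  \big[op/idx]_(s : {perm pm n} | is_pairing (delta n * s)%g)
     F #|porbits s|./2 #|porbits (gammat n * s^-1)%g|./2 =
  op (\big[op/idx]_(a : {perm 'I_n}) F #|porbits a| #|porbits (a^-1 * cyc n)%g|)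
     (\big[op/idx]_(s : {perm pm n} | is_pairing (delta n * s)%g && transitive_with s)
        F #|porbits s|./2 #|porbits (gammat n * s^-1)%g|./2).
Proof.
move=> n0; rewrite (bigID transitive_with) /= Monoid.mulmC; congr (op _ _).
have -> : \big[op/idx]_(s | is_pairing (delta n * s)%g && ~~ transitive_with s)
     F #|porbits s|./2 #|porbits (gammat n * s^-1)%g|./2 =
   \big[op/idx]_(s in (fun a => signed a a^-1%g) @: setT)
     F #|porbits s|./2 #|porbits (gammat n * s^-1)%g|./2.
  apply: eq_bigl => s; apply/andP/imsetP => [[sp nT]|[a _ ->]].
    by have [a ->] := not_transitive_signed sp nT; exists a.
  by rewrite signed_pairing signed_not_transitive.
rewrite big_imset /=; last by move=> a b _ _ /signed_inj.
apply: eq_big => [a|a _]; first by rewrite inE.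
rewrite card_porbits_signed porbitsV addnn doubleK; congr F.
rewrite gammat_signed signedV signedM card_porbits_signed invgK.
rewrite -(porbitsV (_^-1 * a)%g) invMg invgK (card_porbits_mulC (cyc n)) addnn.
exact: doubleK.
Qed.

End Signed.

(** The sum of the cycle counts has a fixed parity, by the sign of permutations,
    so that missing the bound of [euler_cycle] means missing it by at least two. *)
Lemma genus_gap n (a : {perm 'I_n}) : 0 < n -> ~~ genus0 (cyc n) a ->
  #|porbits a| + #|porbits (a^-1 * cyc n)%g| < n.
Proof.
move=> n0; rewrite /genus0 card_ord => na.
have := euler_cycle a (card_porbits_cyc n0); rewrite card_ord.
have : ~~ odd (#|porbits a| + #|porbits (a^-1 * cyc n)%g| + n.+1).
  have oE (s : {perm 'I_n}) : odd #|porbits s| = odd_perm s (+) odd n.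
    by rewrite /odd_perm card_ord addbAC addbb.
  have := oE (cyc n); rewrite card_porbits_cyc // => cE.
  rewrite /= !oddD !oE odd_permM odd_permV -/(~~ _) /=.
  by move: cE; case: (odd_perm a); case: (odd_perm (cyc n)); case: (odd n).
by move: na; lia.
Qed.

(** Composition with [f] identifies functions on [I] with [q]-invariant functions
    on [T], because the fibres of [f] are the orbits of [q]. *)
Lemma card_maps_through (T I K : finType) (p q : {perm T}) (f : T -> I) (g : I -> T) :
  is_pairing p -> is_pairing q -> cancel g f ->
  (forall x, f (q x) = f x) -> (forall x, g (f x) = x \/ g (f x) = q x) ->
  #|[set u : {ffun I -> K} | [forall x, u (f (p x)) == u (f x)]]| =
  #|K| ^ #|porbits (p * q)%g|./2.
Proof.
move=> pP qP gK fq gf; rewrite -card_pairings_invariant //.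
pose c (u : {ffun I -> K}) := [ffun x => u (f x)].
have c_inj : injective c.
  by move=> u v /ffunP e; apply/ffunP => i; have := e (g i); rewrite !ffunE gK.
rewrite -(card_imset _ c_inj); congr #|pred_of_set _|; apply/setP => u.
rewrite inE; apply/imsetP/forallP => [[v]|uP].
  rewrite inE => /forallP vP -> x.
  by rewrite !ffunE fq eqxx andbT.
have uE x : u (g (f x)) = u x.
  by have /andP[_ /eqP uq] := uP x; case: (gf x) => ->.
exists [ffun i => u (g i)].
  rewrite inE; apply/forallP => x; rewrite !ffunE !uE.
  by have /andP[] := uP x.
by apply/ffunP => x; rewrite !ffunE uE.
Qed.

Section Counting.
Variables (n : nat) (K : finType).
Implicit Types (p s : {perm pm n}).

(** The entries of the k-th factor G G^t have row indices k (first entry, sign +)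
    and k+1 (second entry, sign -). *)
Definition row_pos (x : pm n) : 'I_n := if x.1 then x.2 else ordS x.2.

(** The pairing of the positions that share a row index. *)
Definition deltag : {perm pm n} := (delta n ^ gamma n)%g.

Lemma deltagE e i : deltag (e, i) = (~~ e, if e then ord_pred i else ordS i).
Proof.
have -> : (e, i) = gamma n (e, if e then ord_pred i else i).
  by rewrite permE /gamma_fun /=; case: e; rewrite ?ord_predK.
by rewrite permJ deltaE permE /gamma_fun /=; case: e; rewrite ?ord_predK.
Qed.

Lemma deltag_pairing : is_pairing deltag.
Proof.
by apply/is_pairingP => -[[] i]; rewrite !deltagE /= ?ordSK ?ord_predK.
Qed.

(** With p = delta s, both sides are cycle counts of conjugates of p deltag. *)
Lemma pairing_porbits_row s : is_pairing (delta n * s)%g ->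
  #|porbits (delta n * s * deltag)%g| = #|porbits (gammat n * s^-1)%g|.
Proof.
move=> /is_pairingP sp; set p := (delta n * s)%g in sp *.
have pV : (p^-1 = p)%g.
  by apply/permP => x; apply: (@perm_inj _ p); rewrite permKV; case: (sp x).
have -> : (s^-1 = p * delta n)%g.
  by rewrite -[in RHS]pV /p invMg mulgVK.
have -> : gammat n = (delta n * deltag)%g by rewrite /gammat /deltag conjgE !mulgA.
clearbody p; rewrite (mulgA _ p) [in RHS]card_porbits_mulC !mulgA deltaK mul1g.
by rewrite -!mulgA [in LHS]card_porbits_mulC -!mulgA.
Qed.

Lemma card_col_maps s : is_pairing (delta n * s)%g ->
  #|[set u : {ffun 'I_n -> K} |
      [forall x : pm n, u ((delta n * s)%g x).2 == u x.2]]| =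
  #|K| ^ #|porbits s|./2.
Proof.
move=> sp; rewrite (card_maps_through K sp (delta_pairing n) (g := fun i => (true, i))) //.
- by rewrite card_porbits_mulC mulgA deltaK mul1g.
- by move=> [e i]; rewrite deltaE.
- by move=> [[] i]; rewrite deltaE; [left|right].
Qed.

Lemma card_row_maps s : is_pairing (delta n * s)%g ->
  #|[set u : {ffun 'I_n -> K} |
      [forall x : pm n, u (row_pos ((delta n * s)%g x)) == u (row_pos x)]]| =
  #|K| ^ #|porbits (gammat n * s^-1)%g|./2.
Proof.
move=> sp; rewrite (card_maps_through K sp deltag_pairing (g := fun i => (true, i))) //.
- by rewrite pairing_porbits_row.
- by move=> [[] i]; rewrite deltagE /row_pos /= ?ord_predK.
- by move=> [[] i]; rewrite deltagE /row_pos /=; [left|right].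
Qed.

Lemma pairing_even s : is_pairing (delta n * s)%g ->
  ~~ odd #|porbits s| /\ ~~ odd #|porbits (gammat n * s^-1)%g|.
Proof.
move=> sp; split.
  rewrite -[s]mul1g -(deltaK n) -mulgA card_porbits_mulC.
  exact: porbits_pairings_even sp (delta_pairing n).
by rewrite -pairing_porbits_row // porbits_pairings_even // deltag_pairing.
Qed.

Lemma SNCdeltaE s : (s \in SNCdelta n) =
  [&& is_pairing (delta n * s)%g, transitive_with s &
      #|porbits s|./2 + #|porbits (gammat n * s^-1)%g|./2 == n].
Proof.
rewrite inE -/(transitive_with s) /ncycles andbCA andbC -!andbA andbCA.
apply: andb_id2l => sp; apply: andb_id2l => _.
by have [] := pairing_even sp; lia.
Qed.

Lemma transitive_gap s : 0 < n -> is_pairing (delta n * s)%g -> transitive_with s ->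
  s \notin SNCdelta n -> #|porbits s|./2 + #|porbits (gammat n * s^-1)%g|./2 < n.
Proof.
move=> n0 sp st; rewrite SNCdeltaE sp st /=.
have [oA oB] := pairing_even sp; have := card_porbits_transitive n0 st.
rewrite [_ < n]ltn_neqAle => le ->; move: oA oB le.
by move: #|porbits s| #|porbits (gammat n * s^-1)%g| => A B; lia.
Qed.

End Counting.

(** * Index functions compatible with a pairing *)

(** The double factorial (k-1)!! for even k, and 0 for odd k. *)
Fixpoint num_pairings k : nat :=
  match k with 0 => 1 | 1 => 0 | k'.+2 => k'.+1 * num_pairings k' end.

Section Coloured.
Variables (A I : finType) (x : A -> I).
Implicit Types (S : {set A}) (p q : {perm A}) (a b c : A).

Definition coloured_pairings S : {set {perm A}} :=
  [set p : {perm A} | [forall a, if a \in S then [&& p a != a, p (p a) == a & x (p a) == x a]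
                      else p a == a]].

Lemma coloured_pairingsP S p :
  reflect ((forall a, a \in S -> [/\ p a != a, p (p a) = a & x (p a) = x a]) /\
           (forall a, a \notin S -> p a = a)) (p \in coloured_pairings S).
Proof.
rewrite inE; apply: (iffP forallP) => [pS|[pS pC] a].
  split=> a aS; have := pS a; first by rewrite aS => /and3P[? /eqP ? /eqP].
  by rewrite (negbTE aS) => /eqP.
case: ifPn => [/pS[-> -> ->]|/pC ->]; by rewrite !eqxx.
Qed.

(** Deleting the pair {a, b} is multiplication by the transposition. *)
Lemma card_coloured_first S a b : a \in S ->
  b \in [set b in S | (b != a) && (x b == x a)] ->
  #|[set p : {perm A} in coloured_pairings S | p a == b]| =
  #|coloured_pairings (S :\ a :\ b)|.
Proof.
move=> aS; rewrite inE => /and3P[bS ba /eqP xba].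
have ab : a != b by rewrite eq_sym.
have tinj : injective (fun q : {perm A} => (tperm a b * q)%g) by exact: mulgI.
rewrite -[RHS](card_imset _ tinj); congr #|pred_of_set _|; apply/setP => p.
apply/idP/imsetP => [|[q /coloured_pairingsP[qS qC] ->]].
  rewrite inE => /andP[/coloured_pairingsP[pS pC] /eqP pa].
  have pb : p b = a by have [_] := pS a aS; rewrite pa.
  exists (tperm a b * p)%g; last by rewrite mulgA tperm2 mul1g.
  apply/coloured_pairingsP; split=> c; rewrite !inE !permM.
    case/and3P=> cb ca cS; have [pc ppc xpc] := pS c cS.
    have apc : a != p c by apply: contraNneq cb => apc; rewrite -ppc -apc pa.
    have bpc : b != p c by apply: contraNneq ca => bpc; rewrite -ppc -bpc pb.
    have -> : tperm a b c = c by rewrite tpermD // eq_sym.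
    by rewrite tpermD.
  rewrite !negb_and !negbK => /or3P[/eqP ->|/eqP ->|cS].
  - by rewrite tpermR pa.
  - by rewrite tpermL pb.
  - have ac : a != c by apply: contraNneq cS => <-.
    have bc : b != c by apply: contraNneq cS => <-.
    by rewrite tpermD // pC.
have qa : q a = a by rewrite qC // !inE eqxx andbF.
have qb : q b = b by rewrite qC // !inE eqxx.
rewrite inE permM tpermL qb eqxx andbT; apply/coloured_pairingsP; split=> c cS.
  rewrite !permM; case: tpermP => [->|->|ca cb].
  - by rewrite qb tpermR qa.
  - by rewrite qa tpermL qb.
  - have cS' : c \in S :\ a :\ b by rewrite !inE cS andbT; apply/andP; split; apply/eqP.
    have [qc qqc xqc] := qS c cS'.
    have aqc : a != q c by apply: contra_not_neq ca => e; rewrite -qqc -e qa.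
    have bqc : b != q c by apply: contra_not_neq cb => e; rewrite -qqc -e qb.
    by rewrite tpermD.
have ac : a != c by apply: contraNneq cS => <-.
have bc : b != c by apply: contraNneq cS => <-.
by rewrite permM tpermD // qC // !inE !negb_and cS !orbT.
Qed.

Lemma card_coloured_rec S a : a \in S ->
  #|coloured_pairings S| =
  \sum_(b in [set b in S | (b != a) && (x b == x a)]) #|coloured_pairings (S :\ a :\ b)|.
Proof.
move=> aS; set B := [set b in S | _].
rewrite -sum1_card (partition_big (fun p : {perm A} => p a) (mem B)) /=.
  apply: eq_bigr => b bB; rewrite sum1dep_card -(card_coloured_first aS bB).
  by congr #|pred_of_set _|; apply/setP => p; rewrite !inE.
move=> p /coloured_pairingsP[pS pC]; have [pa ppa xpa] := pS a aS.
rewrite inE pa xpa eqxx !andbT; apply: contraNT pa => paS.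
by rewrite -[X in X == _](pC _ paS) ppa.
Qed.

(** Removing the pair of a point [a] leaves a choice among the other points of
    the same colour, which is the recursion of [num_pairings] in that colour. *)
Lemma card_coloured_pairings S :
  #|coloured_pairings S| = \prod_i num_pairings #|[set a in S | x a == i]|.
Proof.
have [m] := ubnP #|S|; elim: m S => // m IH S Sm.
have [->|[a aS]] := set_0Vmem S.
  rewrite big1 => [|i _]; last first.
    by rewrite (_ : [set a in _ | _] = set0) ?cards0 //; apply/setP => a; rewrite !inE.
  apply/eqP/cards1P; exists 1%g; apply/setP => p; rewrite [RHS]inE.
  apply/coloured_pairingsP/eqP => [[_ pC]|->].
    by apply/permP => a; rewrite perm1 pC // inE.
  by split=> a; rewrite inE // perm1.
rewrite (card_coloured_rec aS); set B := [set b in S | _].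
set k := #|[set c in S | x c == x a]|.
have kB : k = #|B|.+1.
  rewrite /k (cardsD1 a) inE aS eqxx add1n; congr _.+1.
  by congr #|pred_of_set _|; apply/setP => c; rewrite !inE andbCA.
pose Q := \prod_(i | i != x a) num_pairings #|[set c in S | x c == i]|.
have step b : b \in B -> #|coloured_pairings (S :\ a :\ b)| = num_pairings #|B|.-1 * Q.
  move=> bB; move: (bB); rewrite inE => /and3P[bS ba /eqP xba].
  rewrite IH; last first.
    rewrite (leq_trans _ (ltnSE Sm)) // (cardsD1 a S) aS add1n ltnS.
    by apply: subset_leq_card; exact: subD1set.
  rewrite (bigD1 (x a)) //=; congr (num_pairings _ * _).
    rewrite (cardsD1 b B) bB add1n /=.
    congr #|pred_of_set _|; apply/setP => c; rewrite !inE.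
    by case: (c == b); case: (c == a); case: (c \in S).
  apply: eq_bigr => i ia; congr (num_pairings #|pred_of_set _|).
  apply/setP => c; rewrite !inE; case: eqP => [->|_] /=.
    by rewrite xba eq_sym (negbTE ia) andbF.
  by case: eqP => [->|_] //=; rewrite eq_sym (negbTE ia) andbF.
rewrite (eq_bigr _ step) sum_nat_const [RHS](bigD1 (x a)) //= -/k kB -/Q mulnA.
by congr (_ * _); case: #|B|.
Qed.

End Coloured.

Lemma coloured_pairings_setT (A I : finType) (x : A -> I) :
  coloured_pairings x setT = [set p : {perm A} | is_pairing p && [forall a, x (p a) == x a]].
Proof.
apply/setP => p; rewrite [RHS]inE.
apply/coloured_pairingsP/andP => [[pT _]|[/is_pairingP pP /forallP px]].
  split; first by apply/is_pairingP => a; have [] := pT a (in_setT a).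
  by apply/forallP => a; have [_ _ ->] := pT a (in_setT a).
by split=> a; rewrite !inE // => _; have [] := pP a; split=> //; apply/eqP.
Qed.

Lemma prod_num_pairings (A I : finType) (x : A -> I) :
  \prod_i num_pairings #|[set a | x a == i]| =
  #|[set p : {perm A} | is_pairing p && [forall a, x (p a) == x a]]|.
Proof.
rewrite -coloured_pairings_setT card_coloured_pairings; apply: eq_bigr => i _.
by congr (num_pairings #|pred_of_set _|); apply/setP => a; rewrite !inE.
Qed.

(** The position in G of the entry labelled by [a], for given row and column index
    functions. *)
Definition entry_pos (n : nat) (K L : finType)
  (u : {ffun 'I_n -> K} * {ffun 'I_n -> L}) (a : pm n) : K * L :=
  (u.1 (row_pos a), u.2 a.2).

(** Exchanging the sums, a pairing p = delta s is compatible with a pair of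
    index functions when each of them is compatible with p, and the two counts are
    [card_row_maps] and [card_col_maps]. *)
Lemma sum_compatible_pairings (n : nat) (K L : finType) :
  \sum_(u : {ffun 'I_n -> K} * {ffun 'I_n -> L})
    #|[set p : {perm pm n} |
        is_pairing p && [forall a, entry_pos u (p a) == entry_pos u a]]| =
  \sum_(s : {perm pm n} | is_pairing (delta n * s)%g)
    #|L| ^ #|porbits s|./2 * #|K| ^ #|porbits (gammat n * s^-1)%g|./2.
Proof.
under eq_bigr do rewrite -sum1dep_card.
rewrite (exchange_big_dep (fun p : {perm pm n} => is_pairing p)) /=; last first.
  by move=> u p _ /andP[].
rewrite (reindex_inj (mulgI (delta n))) /=; apply: eq_bigr => s sp.
rewrite -card_col_maps // -card_row_maps // mulnC -cardsX sum1dep_card.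
congr #|pred_of_set _|; apply/setP => -[f h]; rewrite !inE /= sp /=.
apply/forallP/andP => [fh|[/forallP fP /forallP hP] a].
  by split; apply/forallP => a; have := fh a; rewrite -pair_eqE => /andP[].
by rewrite -pair_eqE /pair_eq /= fP hP.
Qed.

From mathcomp Require Import all_order all_algebra ring lra.

Import Order.TTheory GRing.Theory Num.Theory.
Local Open Scope ring_scope.

(** * Trace of a matrix power *)

Section Walks.
Variables (R : comPzRingType) (N : nat).
Implicit Type A : 'M[R]_N.

Definition ffun_cons (T : finType) m (x : T) (g : {ffun 'I_m -> T}) : {ffun 'I_m.+1 -> T} :=
  [ffun i => if unlift ord0 i is Some j then g j else x].

Lemma ffun_cons0 (T : finType) m (x : T) (g : {ffun 'I_m -> T}) : ffun_cons x g ord0 = x.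
Proof. by rewrite ffunE unlift_none. Qed.

Lemma ffun_consS (T : finType) m (x : T) (g : {ffun 'I_m -> T}) k :
  ffun_cons x g (lift ord0 k) = g k.
Proof. by rewrite ffunE liftK. Qed.

Lemma big_ffun_recl (T : finType) (m : nat) (F : {ffun 'I_m.+1 -> T} -> R) :
  \sum_f F f = \sum_x \sum_(g : {ffun 'I_m -> T}) F (ffun_cons x g).
Proof.
rewrite pair_bigA /= (reindex (fun u : T * {ffun 'I_m -> T} => ffun_cons u.1 u.2)) //.
exists (fun f : {ffun 'I_m.+1 -> T} => (f ord0, [ffun j => f (lift ord0 j)])).
  move=> [x g] _ /=; rewrite ffun_cons0; congr pair.
  by apply/ffunP => j; rewrite ffunE ffun_consS.
move=> f _; apply/ffunP => i; rewrite ffunE /=.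
by case: unliftP => [j ->|->] //; rewrite ffunE.
Qed.

(** Open walks have one vertex more than steps; the trace closes them with the
    step from [ord_max] to [ord0]. *)
Definition walk_weight A m (f : {ffun 'I_m.+1 -> 'I_N}) : R :=
  \prod_(k < m) A (f (widen_ord (leqnSn m) k)) (f (lift ord0 k)).

Lemma walk_weight_cons A m x (g : {ffun 'I_m.+1 -> 'I_N}) :
  walk_weight A (ffun_cons x g) = A x (g ord0) * walk_weight A g.
Proof.
rewrite /walk_weight big_ord_recl ffun_consS; congr (A _ _ * _).
  by rewrite -[RHS](ffun_cons0 x g); congr (ffun_cons _ _ _); apply: val_inj.
apply: eq_bigr => k _; rewrite ffun_consS; congr (A _ _).
by rewrite -(ffun_consS x g); congr (ffun_cons _ _ _); apply: val_inj.
Qed.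

Lemma exp_mx_walks A m i j : (A ^+ m) i j =
  \sum_(f : {ffun 'I_m.+1 -> 'I_N} | (f ord0 == i) && (f ord_max == j)) walk_weight A f.
Proof.
elim: m i => [|m IH] i; rewrite [RHS]big_mkcond /= big_ffun_recl.
  under eq_bigr => x _.
    rewrite (eq_bigr (fun=> if (x == i) && (x == j) then 1 else 0)); last first.
      move=> g _; rewrite (_ : ord_max = ord0); last exact: val_inj.
      by rewrite ffun_cons0 /walk_weight big_ord0.
    rewrite sumr_const card_ffun !card_ord expn0 mulr1n; over.
  rewrite expr0 -big_mkcondr /= -[1]/(1%:M) mxE eq_sym; case: eqP => [->|ij].
    by rewrite (big_pred1 i) // => x; rewrite andbb.
  by rewrite big1 // => x /andP[/eqP -> /eqP e]; case: ij.
rewrite exprS -mulmxE mxE.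
rewrite [RHS](bigD1 i) //= [X in _ = _ + X]big1 ?addr0; last first.
  by move=> x /negbTE xi; rewrite big1 // => g _; rewrite ffun_cons0 xi.
have lastE (g : {ffun 'I_m.+1 -> 'I_N}) x : ffun_cons x g ord_max = g ord_max.
  by rewrite -[RHS](ffun_consS x); congr (ffun_cons _ _ _); apply: val_inj.
under eq_bigr => x _ do rewrite IH big_distrr /=.
rewrite (exchange_big_dep (fun g : {ffun 'I_m.+1 -> 'I_N} => g ord_max == j)) /=; last first.
  by move=> x g _ /andP[].
rewrite big_mkcond /=; apply: eq_bigr => g _.
rewrite ffun_cons0 lastE eqxx walk_weight_cons /=; case: eqP => // _.
by rewrite (big_pred1 (g ord0)) // => x; rewrite andbT eq_sym.
Qed.

Lemma trace_exp_walks A m : \tr (A ^+ m.+1) =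
  \sum_(f : {ffun 'I_m.+1 -> 'I_N}) \prod_k A (f k) (f (ordS k)).
Proof.
transitivity (\sum_i \sum_j (A ^+ m) i j * A j i).
  by apply: eq_bigr => i _; rewrite exprSr -mulmxE mxE.
under eq_bigr => i _ do under eq_bigr => j _ do rewrite exp_mx_walks big_distrl /=.
rewrite pair_bigA /=.
rewrite (exchange_big_dep predT) //=; apply: eq_bigr => f _.
rewrite (big_pred1 (f ord0, f ord_max)) /= => [|[i j]]; last first.
  by rewrite /= -pair_eqE /pair_eq /= ![f _ == _]eq_sym.
rewrite big_ord_recr /=; congr (_ * _).
  apply: eq_bigr => k _; congr (A _ (f _)); apply: val_inj => /=.
  by rewrite modn_small // ltnS.
by congr (A _ (f _)); apply: val_inj; rewrite /= modnn.
Qed.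

End Walks.

(* This import comes late because sets over arbitrary types take over the
   finite-set notations of the combinatorial part. *)
From mathcomp Require Import all_classical all_reals all_analysis.
From mathcomp Require Import measurable_realfun.

Import numFieldNormedType.Exports.
Import HBNNSimple.
Local Open Scope classical_set_scope.

(** * Expectation of a product of independent variables *)

Section Transfer.
Variable R : realType.
Local Open Scope ereal_scope.

(** The right-hand side depends on [X] and [W] only through the integrals of
    [W] over the sets X^-1 B. *)
Lemma weighted_integral_lim d (T : measurableType d) (mu : {measure set T -> \bar R})
    (X W : T -> R) (h : R -> R)
    (mh : measurable_fun [set: R] (EFin \o h)) :
  measurable_fun [set: T] X -> measurable_fun [set: T] W ->
  (forall t, 0 <= W t)%R -> (forall x, 0 <= h x)%R ->
  \int[mu]_t (h (X t) * W t)%:E =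
  limn (fun n => let hn := nnsfun_approx measurableT mh n in
    \sum_(y \in range hn)
      (y%:E * \int[mu]_t (\1_(hn @^-1` [set y]) (X t) * W t)%:E)).
Proof.
move=> mX mW W0 h0; pose hn := nnsfun_approx measurableT mh.
have mhX n : measurable_fun [set: T] (fun t => hn n (X t)).
  by apply: measurableT_comp.
have mind (B : set R) : measurable B ->
    measurable_fun [set: T] (fun t => (\1_B (X t) * W t)%:E).
  move=> mB; apply/measurable_EFinP; apply: measurable_funM => //.
  by apply: measurableT_comp => //; exact: measurable_indic.
have hE t : (h (X t) * W t)%:E = limn (fun n => (hn n (X t) * W t)%:E).
  apply/esym/cvg_lim => //; under eq_fun do rewrite EFinM.
  rewrite EFinM; apply: cvgeZr => //.
  by apply: (@cvg_nnsfun_approx _ _ _ _ measurableT _ mh _ (X t)) => // x _; rewrite lee_fin.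
under eq_integral do rewrite hE.
rewrite monotone_convergence //; last 3 first.
- by move=> n; apply/measurable_EFinP; exact: measurable_funM.
- by move=> n t _; rewrite lee_fin mulr_ge0.
- move=> t _ m n mn; rewrite lee_fin ler_wpM2r //.
  by have /lefP := nd_nnsfun_approx measurableT mh mn; exact.
congr (limn _); apply/funext => n /=.
transitivity (\int[mu]_t \sum_(y \in range (hn n))
    (y%:E * (\1_(hn n @^-1` [set y]) (X t) * W t)%:E)).
  apply: eq_integral => t _.
  rewrite fimfunE EFinM -fsumEFin // ge0_mule_fsuml => [|y].
    by apply: eq_fsbigr => y _; rewrite !EFinM muleA.
  exact: nnfun_muleindic_ge0.
have yind y t : 0 <= y%:E * (\1_(hn n @^-1` [set y]) (X t) * W t)%:E.
  by rewrite EFinM muleA mule_ge0 ?lee_fin ?W0 //; exact: nnfun_muleindic_ge0.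
have mB y : measurable (hn n @^-1` [set y]) by exact: measurable_funPTI.
rewrite ge0_integral_fsum //; last first.
  by move=> y; apply: measurable_funeM; exact: mind.
apply: eq_fsbigr => y /[!inE] -[x _ <-].
rewrite ge0_integralZl ?lee_fin //; first exact: mind.
by move=> t _; rewrite lee_fin mulr_ge0.
Qed.

(** Both independence and the passage to a density are statements about integrals
    over sets X^-1 B; this lemma extends them from indicators to nonnegative
    functions. *)
Lemma weighted_transfer d1 (T1 : measurableType d1) (mu1 : {measure set T1 -> \bar R})
    d2 (T2 : measurableType d2) (mu2 : {measure set T2 -> \bar R})
    (X1 W1 : T1 -> R) (X2 W2 : T2 -> R) (h : R -> R) :
  measurable_fun [set: T1] X1 -> measurable_fun [set: T1] W1 -> (forall t, 0 <= W1 t)%R ->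
  measurable_fun [set: T2] X2 -> measurable_fun [set: T2] W2 -> (forall t, 0 <= W2 t)%R ->
  (forall B : set R, measurable B ->
    \int[mu1]_t (\1_B (X1 t) * W1 t)%:E = \int[mu2]_t (\1_B (X2 t) * W2 t)%:E) ->
  measurable_fun [set: R] h -> (forall x, 0 <= h x)%R ->
  \int[mu1]_t (h (X1 t) * W1 t)%:E = \int[mu2]_t (h (X2 t) * W2 t)%:E.
Proof.
move=> mX1 mW1 W10 mX2 mW2 W20 XW /measurable_EFinP mh h0.
rewrite (weighted_integral_lim mu1 mh) // (weighted_integral_lim mu2 mh) //.
congr (limn _); apply/funext => n /=; apply: eq_fsbigr => y _.
by rewrite XW //; exact: measurable_funPTI.
Qed.

End Transfer.

Section Independence.
Variables (R : realType) (d : measure_display) (T : measurableType d)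
  (P : probability T R) (I : finType) (X : I -> {RV P >-> R}).
Hypothesis indX : mutually_independent X.

Lemma integral_indicZr (Y : T -> R) (c : R) (B : set R) : measurable_fun [set: T] Y ->
  measurable B -> 0 <= c ->
  (\int[P]_t (\1_B (Y t) * c)%:E = P (Y @^-1` B) * c%:E)%E.
Proof.
move=> mY mB c0; under eq_integral do rewrite EFinM.
rewrite ge0_integralZr ?lee_fin //; last first.
  by apply/measurable_EFinP/measurableT_comp => //; exact: measurable_indic.
congr (_ * _)%E; rewrite (eq_integral (fun t => (\1_(Y @^-1` B) t)%:E)) //.
by rewrite integral_indic ?setIT // -[_ @^-1` _]setTI; exact: mY.
Qed.

Lemma measurable_prod_comp (f : I -> R -> R) (p : pred I) :
  (forall i, measurable_fun [set: R] (f i)) ->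
  measurable_fun [set: T] (fun t => \prod_(i | p i) f i (X i t)).
Proof.
move=> mf; under eq_fun do rewrite big_mkcond /=.
apply: measurable_prod => i _; case: (p i); last exact: measurable_cst.
exact: measurableT_comp.
Qed.

(** Independence is the case where every [f i] is an indicator.  The induction
    replaces one indicator at a time by a general function, through
    [weighted_transfer] with the product of the other factors as weight. *)
Lemma independent_prod_integral (f : I -> R -> R) (e : I -> R) :
  (forall i, measurable_fun [set: R] (f i)) -> (forall i x, 0 <= f i x) ->
  (forall i, \int[P]_t (f i (X i t))%:E = (e i)%:E)%E ->
  (\int[P]_t (\prod_i f i (X i t))%:E = (\prod_i e i)%:E)%E.
Proof.
have [s sI] : exists s : seq I, forall i, i \in s by exists (enum I) => i; rewrite mem_enum.
have {sI} : forall i, i \notin s -> exists2 B, measurable B & f i = \1_B.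
  by move=> i; rewrite sI.
elim: s f e => [|i s IH] f e fs mf f0 fe.
  have /choice[B BE] i : exists B, measurable B /\ f i = \1_B.
    by have [] // := fs i; move=> B mB fB; exists B.
  have mB i : measurable (B i) by case: (BE i).
  have fB i : f i = \1_(B i) by case: (BE i).
  have XB i : P (X i @^-1` B i) = (e i)%:E.
    rewrite -fe -[LHS]mule1 -integral_indicZr //.
    by apply: eq_integral => t _; rewrite fB mulr1.
  have := @indX [set: I]%SET B mB.
  under [in RHS]eq_bigr do rewrite XB.
  rewrite prodEFin (eq_bigl xpredT) => [<-|j]; last by rewrite inE.
  set C := \bigcap_(i in _) _.
  have mC : measurable C.
    apply: fin_bigcap_measurable; first exact: finite_finset.
    by move=> j _; rewrite -[_ @^-1` _]setTI; exact: measurable_funPT.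
  rewrite -[C in RHS]setIT -integral_indic //; apply: eq_integral => t _; congr EFin.
  rewrite indicE; case: (boolP (t \in C)) => [/set_mem tC|/negP tC].
    rewrite big1 // => j _; rewrite fB indicE mem_set //.
    by apply: tC => /=; rewrite inE.
  apply/eqP; rewrite prodf_seq_eq0; apply/hasP.
  have [j tj] : exists j, ~ B j (X j t).
    by apply/existsNP => tB; apply: tC; apply/mem_set => j _; exact: tB.
  exists j; rewrite ?mem_index_enum //= fB indicE memNset ?eqxx //.
have e0 j : 0 <= e j.
  by rewrite -lee_fin -fe; apply: integral_ge0 => t _; rewrite lee_fin.
pose W t := \prod_(j | j != i) f j (X j t); pose c := \prod_(j | j != i) e j.
have c0 : 0 <= c by exact: prodr_ge0.
have W0 t : 0 <= W t by exact: prodr_ge0.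
have mW : measurable_fun [set: T] W by exact: measurable_prod_comp.
under eq_integral do rewrite (bigD1 i) //= -/(W _).
rewrite (bigD1 i) //= -/c.
rewrite (@weighted_transfer _ _ _ P _ _ P (X i) W (X i) (fun=> c)) //; last first.
  move=> B mB; rewrite integral_indicZr //.
  pose f' j := if j == i then \1_B else f j.
  pose e' j := if j == i then fine (P (X i @^-1` B)) else e j.
  have mXB : measurable (X i @^-1` B) by rewrite -[_ @^-1` _]setTI; exact: measurable_funPT.
  have ei : e' i = fine (P (X i @^-1` B)) by rewrite /e' eqxx.
  have ec : \prod_(j | j != i) e' j = c.
    by apply: eq_bigr => j /negbTE; rewrite /e' => ->.
  have := IH f' e'; rewrite (bigD1 i) //= ec ei EFinM fineK ?fin_num_measure // => <-.
  - apply: eq_integral => t _; rewrite (bigD1 i) //= /f' eqxx; congr (_ * _)%:E.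
    by apply: eq_bigr => j /negbTE ->.
  - move=> j js; rewrite /f'; case: eqP => [_|/eqP ji]; first by exists B.
    by apply: fs; rewrite inE negb_or ji.
  - by move=> j; rewrite /f'; case: eqP => // _; exact: measurable_indic.
  - by move=> j x; rewrite /f'; case: eqP.
  - move=> j; rewrite /f' /e'; case: eqP => [->|//].
    rewrite fineK ?fin_num_measure // -[RHS]mule1 -integral_indicZr //.
    by apply: eq_integral => t _; rewrite mulr1.
under eq_integral do rewrite EFinM.
rewrite ge0_integralZr ?lee_fin //; last by move=> t _; rewrite lee_fin.
  by rewrite fe EFinM.
by apply/measurable_EFinP/measurableT_comp.
Qed.

End Independence.

(** * Moments of the normal law *)

Section Gaussian.
Variable R : realType.
Local Notation mu := (@lebesgue_measure R).

Definition phi (x : R) : R := normal_peak 1 * expR (- (x ^+ 2 / 2)).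

Lemma normal_pdf_phi : normal_pdf 0 1 = phi.
Proof.
rewrite normal_pdfE ?oner_neq0 //; apply/funext => x; rewrite /phi /normal_fun.
by rewrite subr0 expr1n mulr2n mulNr.
Qed.

Lemma phi_ge0 x : 0 <= phi x.
Proof. by rewrite mulr_ge0 ?normal_peak_ge0 ?expR_ge0. Qed.

Lemma phiN x : phi (- x) = phi x.
Proof. by rewrite /phi sqrrN. Qed.

Lemma is_derive_phi (x : R) : is_derive x 1 phi (- x * phi x).
Proof.
have e : is_derive x 1 (fun y : R => - (y ^+ 2 / 2)) (- x).
  have := @is_deriveN _ _ _ (fun y : R => y ^+ 2 / 2) x 1 x; apply.
  rewrite (_ : (fun _ => _) = (fun y : R => 2^-1 *: y ^+ 2)); last first.
    by apply/funext => y; rewrite mulrC.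
  by apply: is_derive_eq; rewrite /GRing.scale /=; lra.
have c := @is_derive1_comp _ expR (fun y : R => - (y ^+ 2 / 2)) x _ _ (is_derive_expR _) e.
have := @is_deriveZ _ _ _ _ (normal_peak 1 : R) x 1 _ c.
by rewrite /GRing.scale /= => h; apply: is_derive_eq h _; rewrite /phi; ring.
Qed.

Lemma continuous_phi : continuous phi.
Proof. by rewrite -normal_pdf_phi; apply: continuous_normal_pdf; exact: oner_neq0. Qed.

Lemma continuous_Xphi k : continuous (fun x : R => x ^+ k * phi x).
Proof. by move=> x; apply: cvgM; [exact: exprn_continuous|exact: continuous_phi]. Qed.

Lemma continuous_absXphi k : continuous (fun x : R => `|x| ^+ k * phi x).
Proof.
move=> x; apply: cvgM; last exact: continuous_phi.
apply: (@continuous_comp _ _ _ (@Num.norm _ R) (fun y : R => y ^+ k)).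
  exact: norm_continuous.
exact: exprn_continuous.
Qed.

Lemma is_derive_Xphi k (x : R) :
  is_derive x 1 (fun y : R => y ^+ k.+1 * phi y)
    (k.+1%:R * (x ^+ k * phi x) - x ^+ k.+2 * phi x).
Proof.
have p := is_derive_phi x.
have q : is_derive x 1 (fun y : R => y ^+ k.+1) (k.+1%:R * x ^+ k).
  have := @is_deriveX _ _ (@id R) k.+1 x 1 1 (is_derive_id _ _).
  rewrite /= [_ *: _]mulr1 (_ : id ^+ k.+1 = (fun y : R => y ^+ k.+1)) //.
  by apply/funext => y; rewrite fctE.
have h := @is_deriveM _ _ _ _ _ _ _ _ q p.
by apply: is_derive_eq h _; rewrite /GRing.scale /= !exprS; ring.
Qed.

(** exp(t) >= t^(k+1)/(k+1)! at t = n^2/2 bounds the sequence by a multiple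
    of 1/n. *)
Lemma cvg_Xphi k : (n%:R ^+ k * phi n%:R : R) @[n --> \oo] --> (0 : R).
Proof.
pose C : R := normal_peak 1 * (k.+1)`!%:R * 2 ^+ k.+1.
have C0 : 0 <= C by rewrite !mulr_ge0 ?normal_peak_ge0 ?exprn_ge0.
have bound n : (n.+1)%:R ^+ k * phi (n.+1)%:R <= C * (n.+1%:R)^-1.
  rewrite /phi; set x : R := n.+1%:R; set t := x ^+ 2 / 2; have x0 : 0 < x by rewrite ltr0n.
  have x1 : 1 <= x by rewrite ler1n.
  have t0 : 0 < t by rewrite divr_gt0 // exprn_gt0.
  have f0 : 0 < (k.+1)`!%:R :> R by rewrite ltr0n fact_gt0.
  have Ele : expR (- t) <= (k.+1)`!%:R / t ^+ k.+1.
    rewrite expRN -[leRHS]invf_div lef_pV2 ?posrE ?expR_gt0 ?divr_gt0 ?exprn_gt0 //.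
    by apply: le_trans (expR_ge1Dxn k (ltW t0)); rewrite lerDr.
  have key : x ^+ k / t ^+ k.+1 <= 2 ^+ k.+1 / x.
    rewrite ler_pdivrMr ?exprn_gt0 // mulrAC -exprMn mulrCA divff ?pnatr_eq0 // mulr1.
    rewrite ler_pdivlMr // -exprSr -exprM; apply: ler_weXn2l => //.
    by rewrite mul2n -addnn leq_addl.
  apply: (@le_trans _ _ (normal_peak 1 * ((k.+1)`!%:R * (x ^+ k / t ^+ k.+1)))).
    rewrite mulrCA ler_wpM2l ?normal_peak_ge0 // mulrCA ler_wpM2l ?exprn_ge0 // ltW //.
  by rewrite /C -!mulrA ler_wpM2l ?normal_peak_ge0 // ler_wpM2l // ltW.
have h : (C * (n.+1%:R)^-1 : R) @[n --> \oo] --> (0 : R).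
  by rewrite -[X in _ --> X](mulr0 C); apply: cvgM; [exact: cvg_cst|exact: cvg_harmonic].
rewrite -cvg_shiftS; apply: squeeze_cvgr h; last exact: cvg_cst.
by apply: nearW => n /=; rewrite bound andbT mulr_ge0 ?exprn_ge0 ?phi_ge0.
Qed.

(** The moments of the standard normal density on the half line.  They keep odd
    powers nonnegative, so that monotone convergence suffices throughout; the full
    moments come back as signed sums of the two halves. *)
Fixpoint half_moment k : R :=
  match k with 0%N => 1 / 2 | 1%N => phi 0 | k'.+2 => k'.+1%:R * half_moment k' end.

Lemma half_moment_rec k : half_moment k.+2 = k.+1%:R * half_moment k.
Proof. by []. Qed.

Lemma absX_itv0y k : (\int[mu]_(x in `[0%R, +oo[) (`|x| ^+ k * phi x)%:E =
  \int[mu]_(x in `[0%R, +oo[) (x ^+ k * phi x)%:E)%E.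
Proof.
apply: eq_integral => x; rewrite inE /= in_itv /= andbT => x0.
by rewrite ger0_norm.
Qed.

Lemma absX_itv0n k (b : R) : (\int[mu]_(x in `[0%R, b]) (`|x| ^+ k * phi x)%:E =
  \int[mu]_(x in `[0%R, b]) (x ^+ k * phi x)%:E)%E.
Proof.
apply: eq_integral => x; rewrite inE /= in_itv /= => /andP[x0 _].
by rewrite ger0_norm.
Qed.

Lemma absXphi_ge0 k x : 0 <= `|x| ^+ k * phi x.
Proof. by rewrite mulr_ge0 ?exprn_ge0 ?phi_ge0. Qed.

Lemma measurable_absXphi k : measurable_fun [set: R] (fun x : R => `|x| ^+ k * phi x).
Proof. by apply: continuous_measurable_fun; exact: continuous_absXphi. Qed.

(** Integration by parts, as the derivative of x^(k+1) phi is
    (k+1) x^k phi - x^(k+2) phi. *)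
Lemma parts_Xphi k (b : R) : 0 < b ->
  (\int[mu]_(x in `[0%R, b]) (x ^+ k.+2 * phi x)%:E =
   k.+1%:R%:E * \int[mu]_(x in `[0%R, b]) (x ^+ k * phi x)%:E - (b ^+ k.+1 * phi b)%:E)%E.
Proof.
move=> b0; pose F x := x ^+ k.+1 * phi x.
pose f x := k.+1%:R * (x ^+ k * phi x) - x ^+ k.+2 * phi x.
have cX j : {within `[0, b], continuous (fun x : R => x ^+ j * phi x)}.
  exact/continuous_subspaceT/continuous_Xphi.
have iX j : mu.-integrable `[0, b] (fun x => (x ^+ j * phi x)%:E).
  by apply: continuous_compact_integrable; [exact: segment_compact|exact: cX].
have cF := @continuous_Xphi k.+1.
have := @continuous_FTC2 R f F 0 b b0.
have F0 : F 0 = 0 by rewrite /F expr0n mul0r.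
rewrite F0 sube0 => FTC.
have {FTC} <- : (\int[mu]_(x in `[0%R, b]) (f x)%:E = (F b)%:E)%E.
  apply: FTC.
  - apply: continuous_subspaceT => x; apply: cvgB; last exact: continuous_Xphi.
    by apply: cvgM; [exact: cvg_cst|exact: continuous_Xphi].
  - split.
    + by move=> x _; have [] := is_derive_Xphi k x.
    + exact/cvg_at_right_filter/cF.
    + exact/cvg_at_left_filter/cF.
  - by move=> x _; rewrite derive1E; have [_ ->] := is_derive_Xphi k x.
rewrite /f; under [in X in (_ - X)%E]eq_integral do rewrite EFinB EFinM.
rewrite integralB //; last exact: integrableZl.
rewrite integralZl // oppeB ?fin_num_adde_defl ?integrable_fin_num //.
rewrite addeA subee ?add0e // fin_numM // integrable_fin_num //.
by rewrite fin_numN integrable_fin_num.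
Qed.

(** The value for k = 0 is half the total mass, for k = 1 there is an explicit
    antiderivative, and the recursion is the limit of [parts_Xphi]. *)
Lemma integral_half_moment k :
  (\int[mu]_(x in `[0%R, +oo[) (`|x| ^+ k * phi x)%:E = (half_moment k)%:E)%E.
Proof.
have [m] := ubnP k; elim: m k => // m IH [|[|k]] km.
- have := integral_normal_pdf (0 : R) 1; rewrite normal_pdf_phi.
  rewrite ge0_symfun_integralT; last 3 first.
  + exact: phi_ge0.
  + exact: continuous_phi.
  + by move=> x; rewrite /= phiN.
  rewrite -set_itvcy => e.
  under eq_integral do rewrite expr0 mul1r.
  have h : 1 = 2^-1 * 2 :> R by lra.
  by rewrite -[LHS]mul1e {1}h EFinM -muleA e mule1 /= mul1r.
- rewrite absX_itv0y; under eq_integral do rewrite expr1.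
  rewrite (@ge0_continuous_FTC2y R (fun x => x * phi x) (fun x => - phi x) 0 0).
  + by rewrite sub0e EFinN oppeK.
  + by move=> x x0; rewrite mulr_ge0 ?phi_ge0.
  + by apply: continuous_subspaceT => x; apply: cvgM => //; exact: continuous_phi.
  + rewrite -oppr0; apply: cvgN; rewrite -[X in _ --> X](mulr0 (normal_peak 1)).
    apply: cvgM; first exact: cvg_cst.
    apply: (cvg_comp (fun x : R => x ^+ 2 / 2) (fun y => expR (- y))); last exact: cvgr_expR.
    apply: gt0_cvgMly => //; exact: cvgr_expr2.
  + by move=> x _; apply: derivableN; have [] := is_derive_phi x.
  + by apply: cvgN; exact/cvg_at_right_filter/continuous_phi.
  + by move=> x _; rewrite derive1E deriveN; have [h e] := is_derive_phi x;
      rewrite ?e ?mulNr ?opprK.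
- have c := @ge0_cvgn_integral R mu _ (absXphi_ge0 k.+2) (measurable_absXphi _).
  have c' := @ge0_cvgn_integral R mu _ (absXphi_ge0 k) (measurable_absXphi _).
  rewrite IH in c'; last by rewrite (leq_trans _ (ltnSE km)).
  have {}c' : (k.+1%:R%:E * \int[mu]_(x in `[0%R, n%:R]) (`|x| ^+ k * phi x)%:E
     - (n%:R ^+ k.+1 * phi n%:R)%:E)%E @[n --> \oo] --> (half_moment k.+2)%:E.
    rewrite half_moment_rec EFinM -[X in _ --> X]sube0; apply: cvgeB => //.
      by apply: cvgeZl => //.
    by apply: cvg_EFin; [exact: nearW|exact: cvg_Xphi].
  rewrite -(cvg_lim _ c) //; apply: cvg_lim => //; apply: cvg_trans c'; apply: near_eq_cvg.
  near=> n; rewrite !absX_itv0n parts_Xphi //.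
  by near: n; exists 1%N => // n /= n1; rewrite ltr0n.
Unshelve. all: by end_near.
Qed.

End Gaussian.

(** * Wick's formula and the genus expansion *)

Section Moments.
Variable R : realType.
Local Notation mu := (@lebesgue_measure R).

Definition half_power (e : bool) k (x : R) : R :=
  if (0 <= x) == e then `|x| ^+ k else 0.

Lemma half_power_ge0 e k x : 0 <= half_power e k x.
Proof. by rewrite /half_power; case: ifP => // _; exact: exprn_ge0. Qed.

Lemma exp_half_power k x :
  x ^+ k = \sum_(e : bool) (if e then 1 else (-1) ^+ k) * half_power e k x.
Proof.
rewrite big_bool /half_power /=; case: (ltP x 0) => x0 /=.
  by rewrite mulr0 add0r ltr0_norm // -exprMn mulN1r opprK.
by rewrite mulr0 addr0 mul1r ger0_norm.
Qed.

Lemma measurable_half_power e k : measurable_fun [set: R] (half_power e k).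
Proof.
have mabs : measurable_fun [set: R] (fun x : R => `|x| ^+ k).
  by apply: measurable_funX; exact: normr_measurable.
apply: measurable_fun_ifT => //.
case: e.
  under eq_fun do rewrite eqb_id.
  exact: measurable_fun_ler.
under eq_fun do rewrite eqbF_neg -ltNge.
exact: measurable_fun_ltr.
Qed.

Lemma integral_half_power_phi e k :
  (\int[mu]_x (half_power e k x * phi x)%:E = (half_moment R k)%:E)%E.
Proof.
pose g (x : R) : \bar R := (`|x| ^+ k * phi x)%:E.
have mg : measurable_fun [set: R] g.
  by apply/measurable_EFinP; exact: measurable_absXphi.
case: e.
  rewrite -integral_half_moment [RHS]integral_mkcond; apply: eq_integral => x _.
  rewrite patchE /half_power eqb_id.
  case: ifPn => x0; first by rewrite mem_set //= in_itv /= x0.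
  by rewrite memNset ?mul0r //= in_itv /= andbT; exact/negP.
transitivity (\int[mu]_(x in `]-oo, 0%R[) g x)%E.
  rewrite [RHS]integral_mkcond; apply: eq_integral => x _.
  rewrite patchE /half_power eqbF_neg -ltNge.
  case: ifPn => x0; first by rewrite mem_set //= in_itv /= x0.
  by rewrite memNset ?mul0r //= in_itv /=; exact/negP.
rewrite integral_itv_bndo_bndc; last exact: measurable_funTS.
rewrite -integral_half_moment (ge0_integration_by_substitution0 mg); last first.
  by move=> r; rewrite lee_fin absXphi_ge0.
by apply: eq_integral => x _; rewrite /g normrN phiN.
Qed.

(** The moment of order k of the standard normal law: the two halves cancel for
    odd k and add for even k. *)
Lemma num_pairings_half_moment k :
  (num_pairings k)%:R = \sum_(e : bool) (if e then 1 else (-1) ^+ k) * half_moment R k :> R.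
Proof.
rewrite big_bool /= mul1r.
have [m] := ubnP k; elim: m k => // m IH [|[|k]] km.
- by rewrite /= expr0; lra.
- by rewrite /= expr1 mulN1r subrr.
- have -> : num_pairings k.+2 = (k.+1 * num_pairings k)%N by [].
  rewrite natrM IH; last by rewrite (leq_trans _ (ltnSE km)).
  by rewrite half_moment_rec !exprS; ring.
Qed.

End Moments.

Section Wick.
Variables (R : realType) (d : measure_display) (T : measurableType d)
  (P : probability T R) (I : finType) (X : I -> {RV P >-> R}).
Hypothesis indX : mutually_independent X.
Hypothesis normX : forall i (A : set R), measurable A ->
  distribution P (X i) A = normal_prob 0 1 A.

Lemma integral_half_power e k i :
  (\int[P]_t (half_power e k (X i t))%:E = (half_moment R k)%:E)%E.
Proof.
have h := @weighted_transfer R _ _ P _ _ (@lebesgue_measure R) (X i) (fun=> 1) id (@phi R)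
  (half_power e k).
have : (\int[P]_t (half_power e k (X i t) * 1)%:E =
        \int[@lebesgue_measure R]_x (half_power e k x * phi x)%:E)%E.
  apply: h => //.
  - by apply: continuous_measurable_fun; exact: continuous_phi.
  - exact: phi_ge0.
  - move=> B mB; rewrite integral_indicZr // mule1.
    have := normX i mB; rewrite /distribution /pushforward => ->.
    rewrite /normal_prob normal_pdf_phi [LHS]integral_mkcond; apply: eq_integral => x _.
    by rewrite patchE indicE; case: ifP => _; rewrite ?mul1r ?mul0r.
  - exact: measurable_half_power.
  - exact: half_power_ge0.
rewrite integral_half_power_phi => <-; apply: eq_integral => t _; by rewrite mulr1.
Qed.

(** Each power is split into its two nonnegative halves, and the product over [I]
    of these sums is expanded, so that [independent_prod_integral] applies to every
    term. *)
Lemma moments_prod (m : I -> nat) :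
  P.-integrable [set: T] (fun t => (\prod_i X i t ^+ m i)%:E) /\
  (\int[P]_t (\prod_i X i t ^+ m i)%:E = (\prod_i (num_pairings (m i))%:R)%:E)%E.
Proof.
pose sg (e : bool) k : R := if e then 1 else (-1) ^+ k.
pose H (f : {ffun I -> bool}) t := \prod_i half_power (f i) (m i) (X i t).
have HE (f : {ffun I -> bool}) :
    (\int[P]_t (H f t)%:E = (\prod_i half_moment R (m i))%:E)%E.
  apply: (independent_prod_integral indX (f := fun i => half_power (f i) (m i))).
  - by move=> i; exact: measurable_half_power.
  - by move=> i x; exact: half_power_ge0.
  - by move=> i; exact: integral_half_power.
have mH (f : {ffun I -> bool}) : measurable_fun [set: T] (EFin \o H f).
  apply/measurable_EFinP.
  apply: (measurable_prod_comp _ (f := fun i => half_power (f i) (m i))).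
  by move=> i; exact: measurable_half_power.
have iH (f : {ffun I -> bool}) : P.-integrable [set: T] (EFin \o H f).
  apply/integrableP; split; first exact: mH.
  under eq_integral => t _.
    rewrite /= ger0_norm; last by apply: prodr_ge0 => i _; exact: half_power_ge0.
    over.
  by rewrite HE ltry.
have expand t : \prod_i X i t ^+ m i =
    \sum_(f : {ffun I -> bool}) (\prod_i sg (f i) (m i)) * H f t.
  under eq_bigr do rewrite exp_half_power.
  by rewrite bigA_distr_bigA /=; apply: eq_bigr => f _; rewrite big_split.
have iZ (f : {ffun I -> bool}) :
    P.-integrable [set: T] (fun t => ((\prod_i sg (f i) (m i)) * H f t)%:E).
  have := integrableZl measurableT (\prod_i sg (f i) (m i)) (iH f).
  by apply: eq_integrable => // t _; rewrite EFinM.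
under eq_integral do rewrite expand.
under eq_fun do rewrite expand.
split.
  under eq_fun do rewrite -sumEFin.
  exact: integrable_sum.
under eq_integral do rewrite -sumEFin.
rewrite integral_sum //.
have each (f : {ffun I -> bool}) : (\int[P]_t ((\prod_i sg (f i) (m i)) * H f t)%:E =
    (\prod_i (sg (f i) (m i) * half_moment R (m i)))%:E)%E.
  under eq_integral do rewrite EFinM.
  by rewrite integralZl //; [rewrite HE -EFinM big_split|exact: iH].
rewrite (eq_bigr _ (fun f _ => each f)).
rewrite sumEFin; congr EFin.
rewrite -(bigA_distr_bigA (fun i e => sg e (m i) * half_moment R (m i))) /=.
by apply: eq_bigr => i _; rewrite num_pairings_half_moment.
Qed.

(** Wick's formula for words in independent standard normal variables: grouping
    equal letters, the moments count the pairings of each group. *)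
Lemma wick (A : finType) (x : A -> I) :
  P.-integrable [set: T] (fun t => (\prod_a X (x a) t)%:E) /\
  (\int[P]_t (\prod_a X (x a) t)%:E =
   #|[set p : {perm A} | is_pairing p && [forall a, x (p a) == x a]]%SET|%:R%:E)%E.
Proof.
have e t : \prod_a X (x a) t = \prod_i X i t ^+ #|[set a | x a == i]%SET|.
  rewrite (partition_big x predT) //=; apply: eq_bigr => i _.
  rewrite (eq_bigr (fun=> X i t)) => [|a /eqP -> //].
  by rewrite prodr_const; congr (_ ^+ _); apply: eq_card => a; rewrite !inE.
under eq_fun do rewrite e.
rewrite -prod_num_pairings natr_prod; exact: moments_prod.
Qed.

End Wick.

Section Expectation.
Variables (R : realType) (d : measure_display) (T : measurableType d)
  (P : probability T R) (N M : nat) (G : 'I_N -> 'I_M -> {RV P >-> R}).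

Lemma ntr_wishart_expand n w : (0 < n)%N ->
  ntr (wishart G w ^+ n) = N%:R^-1 ^+ n.+1 *
    \sum_(u : {ffun 'I_n -> 'I_N} * {ffun 'I_n -> 'I_M})
      \prod_(a : pm n) G (entry_pos u a).1 (entry_pos u a).2 w.
Proof.
case: n => // m _; rewrite /ntr trace_exp_walks [in RHS]exprS -mulrA; congr (_ * _).
have pairE (F : {ffun 'I_m.+1 -> 'I_N} * {ffun 'I_m.+1 -> 'I_M} -> R) :
    \sum_u F u = \sum_f \sum_h F (f, h).
  by rewrite pair_bigA; apply: eq_bigr => -[].
rewrite pairE big_distrr /=; apply: eq_bigr => f _.
have WE i j : wishart G w i j = N%:R^-1 * \sum_l G i l w * G j l w.
  rewrite /wishart !mxE; congr (_ * _); apply: eq_bigr => l _; by rewrite !mxE.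
under eq_bigr do rewrite WE.
rewrite big_split /= prodr_const card_ord; congr (_ * _).
rewrite bigA_distr_bigA /=; apply: eq_bigr => h _.
transitivity (\prod_(e : bool) \prod_(k < m.+1)
    (G (entry_pos (f, h) (e, k)).1 (entry_pos (f, h) (e, k)).2 w : R)).
  by rewrite big_bool /= -big_split.
by rewrite pair_bigA; apply: eq_bigr => -[].
Qed.

Hypothesis hG : iid_std_normal G.

Lemma expectation_ntr_wishart n : (0 < n)%N ->
  ('E_P[fun w => ntr (wishart G w ^+ n)] =
   (N%:R^-1 ^+ n.+1 * (\sum_(s : {perm pm n} | is_pairing (delta n * s)%g)
     M ^ #|porbits s|./2 * N ^ #|porbits (gammat n * s^-1)%g|./2)%N%:R)%:E)%E.
Proof.
move=> n0; have [indG normG] := hG.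
have W u := @wick R d T P _ _ indG (fun i A => @normG i.1 i.2 A) _ (@entry_pos n 'I_N 'I_M u).
have := @sum_compatible_pairings n 'I_N 'I_M; rewrite !card_ord => <-.
rewrite unlock; under eq_integral do rewrite ntr_wishart_expand // EFinM -sumEFin.
have iu u := (W u).1.
rewrite integralZl //; last exact: integrable_sum.
rewrite integral_sum //; under eq_bigr do rewrite (W _).2.
by rewrite sumEFin -EFinM natr_sum.
Qed.

End Expectation.

(** * The limit *)

Section Limits.
Variables (R : realType) (c c' : R) (M : nat -> nat).
Hypothesis c_gt0 : 0 < c.
Hypothesis hMc : ((M N)%:R / N%:R : R) @[N --> \oo] --> c.
Hypothesis hMc' : ((M N)%:R - c * N%:R : R) @[N --> \oo] --> c'.

Local Notation ratio N := ((M N)%:R / N%:R : R).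
Local Notation term n a b N := (N%:R^-1 ^+ n.+1 * (M N ^ a * N ^ b)%N%:R : R).

Lemma near_pos : \forall N \near \oo, (0 < N)%N.
Proof. by exists 1%N. Qed.

Lemma cvg_ratioX k : (ratio N ^+ k) @[N --> \oo] --> c ^+ k.
Proof. exact: (cvg_comp _ _ hMc (@exprn_continuous R k c)). Qed.

Lemma cvg_fin_sum (I : finType) (p : pred I) (f : I -> nat -> R) (l : I -> R) :
  (forall i, p i -> f i N @[N --> \oo] --> l i) ->
  \sum_(i | p i) f i N @[N --> \oo] --> \sum_(i | p i) l i.
Proof. by move=> fl; apply: cvg_big => //; exact: add_continuous. Qed.

(** The three regimes of a term of the genus expansion: [term_top] and
    [cvg_term_top] for spheres, [cvg_term_eq] for the next order, [cvg_term_lt] for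
    the remainder. *)
Lemma term_top n a b : (a + b = n.+1)%N ->
  \forall N \near \oo, term n a b N = ratio N ^+ a.
Proof.
move=> ab; near=> N.
have N0 : N%:R != 0 :> R by rewrite pnatr_eq0 -lt0n; near: N; exact: near_pos.
rewrite -ab natrM !natrX expr_div_n exprVn exprD; field.
by rewrite !expf_eq0 (negbTE N0) !andbF.
Unshelve. all: by end_near. Qed.

Lemma term_sub n a b : (a + b <= n)%N ->
  \forall N \near \oo, N%:R * term n a b N = ratio N ^+ a * (N%:R^-1) ^+ (n - (a + b)).
Proof.
move=> ab; near=> N.
have N0 : N%:R != 0 :> R by rewrite pnatr_eq0 -lt0n; near: N; exact: near_pos.
rewrite -{1}(subnKC ab) natrM !natrX expr_div_n !exprVn exprS !exprD; field.
by rewrite !expf_eq0 (negbTE N0) !andbF.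
Unshelve. all: by end_near. Qed.

Lemma cvg_invn : (N%:R^-1 : R) @[N --> \oo] --> (0 : R).
Proof. by rewrite -cvg_shiftS; exact: cvg_harmonic. Qed.

Lemma cvg_term_eq n a b : (a + b = n)%N -> N%:R * term n a b N @[N --> \oo] --> c ^+ a.
Proof.
move=> ab; have r := @cvg_ratioX a; apply: cvg_trans r; apply: near_eq_cvg.
have := @term_sub n a b; rewrite ab subnn => /(_ (leqnn _)).
by apply: filterS => N ->; rewrite expr0 mulr1.
Qed.

Lemma cvg_term_lt n a b : (a + b < n)%N -> N%:R * term n a b N @[N --> \oo] --> (0 : R).
Proof.
move=> ab; have -> : (0 : R) = c ^+ a * 0 ^+ (n - (a + b)).
  by rewrite expr0n subn_eq0 leqNgt ab mulr0.
have r : ratio N ^+ a * (N%:R^-1) ^+ (n - (a + b)) @[N --> \oo] -->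
    c ^+ a * 0 ^+ (n - (a + b)).
  by apply: cvgM (@cvg_ratioX a) _; exact: (cvg_comp _ _ cvg_invn (@exprn_continuous R _ 0)).
apply: cvg_trans r.
apply: near_eq_cvg; have := @term_sub n a b (ltnW ab).
by apply: filterS => N ->.
Qed.

(** (M/N)^a - c^a is (M/N - c) times the sum of the (M/N)^(a-1-i) c^i, each of
    which tends to c^(a-1). *)
Lemma cvg_term_top n a b : (a + b = n.+1)%N ->
  N%:R * (term n a b N - c ^+ a) @[N --> \oo] --> c' * a%:R * c ^+ a.-1.
Proof.
move=> ab.
have lim : ((M N)%:R - c * N%:R) * (\sum_(i < a) ratio N ^+ (a.-1 - i) * c ^+ i)
    @[N --> \oo] --> c' * (\sum_(i < a) c ^+ (a.-1 - i) * c ^+ i).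
  apply: cvgM hMc' _; apply: cvg_fin_sum => i _.
  by apply: cvgM; [exact: cvg_ratioX|exact: cvg_cst].
have sumE : \sum_(i < a) c ^+ (a.-1 - i) * c ^+ i = a%:R * c ^+ a.-1.
  rewrite (eq_bigr (fun=> c ^+ a.-1)) => [|i _].
    by rewrite sumr_const card_ord mulr_natl.
  by rewrite -exprD subnK // -ltnS (ltn_predK (ltn_ord i)) ltn_ord.
rewrite sumE mulrA in lim; apply: cvg_trans lim; apply: near_eq_cvg.
have := term_top ab; apply: filterS2 near_pos => N N0 ->.
rewrite subrXX mulrA; congr (_ * _).
by rewrite mulrBr mulrCA divff ?mulr1 1?mulrC // pnatr_eq0 -lt0n.
Qed.

(** The genus expansion is split by [big_pairings], and the subtracted sum over
    [NC n] is distributed over the permutations of genus zero by [big_NC]; then each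
    term has a limit. *)
Lemma cvg_expansion n : (0 < n)%N ->
  N%:R * (N%:R^-1 ^+ n.+1 * (\sum_(s : {perm pm n} | is_pairing (delta n * s)%g)
     M N ^ #|porbits s|./2 * N ^ #|porbits (gammat n * s^-1)%g|./2)%N%:R
     - \sum_(p in NC n) c ^+ #|p|) @[N --> \oo] -->
  \sum_(p in NC n) c' * #|p|%:R * c ^+ #|p|.-1
   + \sum_(s in SNCdelta n) c `^ ((ncycles s)%:R / 2).
Proof.
move=> n0; pose Q s := is_pairing (delta n * s)%g && transitive_with s.
pose A (s : {perm pm n}) := #|porbits s|./2.
pose B (s : {perm pm n}) := #|porbits (gammat n * s^-1)%g|./2.
pose f (a : {perm 'I_n}) N := N%:R * (term n #|porbits a| #|porbits (a^-1 * cyc n)%g| N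
  - (if genus0 (cyc n) a then c ^+ #|porbits a| else 0)) : R.
pose g (s : {perm pm n}) N := N%:R * term n (A s) (B s) N : R.
pose lf (a : {perm 'I_n}) : R :=
  if genus0 (cyc n) a then c' * #|porbits a|%:R * c ^+ #|porbits a|.-1 else 0.
pose lg (s : {perm pm n}) : R := if s \in SNCdelta n then c ^+ A s else 0.
have fl a : f a N @[N --> \oo] --> lf a.
  rewrite /f /lf; case: ifPn => [/eqP a0|a0].
    by apply: cvg_term_top; rewrite a0 card_ord.
  under eq_fun do rewrite subr0.
  exact: cvg_term_lt (genus_gap n0 a0).
have gl s : Q s -> g s N @[N --> \oo] --> lg s.
  move=> /andP[sp st]; rewrite /g /lg; case: ifPn => [|sN].
    by rewrite SNCdeltaE => /and3P[_ _ /eqP]; exact: cvg_term_eq.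
  exact: cvg_term_lt (transitive_gap n0 sp st sN).
have lim : \sum_a f a N + \sum_(s | Q s) g s N @[N --> \oo] -->
    \sum_a lf a + \sum_(s | Q s) lg s.
  by apply: cvgD; apply: cvg_fin_sum.
have -> : \sum_(p in NC n) c' * #|p|%:R * c ^+ #|p|.-1 = \sum_a lf a.
  by rewrite (big_NC _ (fun k => c' * k%:R * c ^+ k.-1)) // big_mkcond.
have -> : \sum_(s in SNCdelta n) c `^ ((ncycles s)%:R / 2) = \sum_(s | Q s) lg s.
  rewrite [RHS]big_mkcond [LHS]big_mkcond; apply: eq_bigr => s _.
  rewrite /lg; case: ifPn => [|_]; last by rewrite if_same.
  rewrite SNCdeltaE /Q => /and3P[sp st _]; rewrite sp st /=.
  have [se _] := pairing_even sp.
  rewrite /ncycles -powR_mulrn; last exact: ltW.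
  by congr (_ `^ _); rewrite -[in LHS](even_halfK se) -/(A s) -muln2 natrM mulfK //.
rewrite [X in X @ _ --> _](_ : _ = fun N => \sum_a f a N + \sum_(s | Q s) g s N) //.
apply/funext => N.
rewrite (big_NC _ (fun k => c ^+ k)) // [\sum_(a | genus0 _ a) _]big_mkcond /=.
rewrite (big_pairings _ (fun a b => M N ^ a * N ^ b)%N) // natrD.
rewrite [X in X - _]mulrDr addrAC mulrDr; congr (_ + _).
  by rewrite natr_sum mulr_sumr -sumrB mulr_sumr.
by rewrite natr_sum !mulr_sumr.
Qed.

End Limits.

Unset Implicit Arguments.

Theorem corollary18 (R : realType) (c c' : R) (hc : 0 < c)
  (M : nat -> nat) (hM : forall N, (0 < M N)%N)
  (hMc : ((M N)%:R / N%:R : R) @[N --> \oo] --> c)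
  (hMc' : ((M N)%:R - c * N%:R : R) @[N --> \oo] --> c')
  (d : nat -> measure_display) (T : forall N, measurableType (d N))
  (P : forall N, probability (T N) R)
  (G : forall N, 'I_N -> 'I_(M N) -> {RV (P N) >-> R})
  (hG : forall N, iid_std_normal (G N))
  (n : nat) (hn : (1 <= n)%N) :
  (N%:R%:E * ('E_(P N)[fun w => ntr (wishart (G N) w ^+ n)]
              - (\sum_(p in NC n) c ^+ #|p|)%:E))%E @[N --> \oo] -->
  (\sum_(p in NC n) c' * #|p|%:R * c ^+ #|p|.-1
   + \sum_(s in SNCdelta n) c `^ ((ncycles s)%:R / 2))%:E.
Proof.
rewrite [X in X @ _ --> _](_ : _ = fun N => (N%:R * (N%:R^-1 ^+ n.+1 *
    (\sum_(s : {perm pm n} | is_pairing (delta n * s)%g)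
       M N ^ #|porbits s|./2 * N ^ #|porbits (gammat n * s^-1)%g|./2)%N%:R
    - \sum_(p in NC n) c ^+ #|p|))%:E); last first.
  by apply/funext => N; rewrite (expectation_ntr_wishart (hG N) hn) -EFinB -EFinM.
by apply: cvg_EFin; [exact: nearW|exact: cvg_expansion].
Qed.
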